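(* Let $m=1$, $\delta>-1$, and let $r\ge 2$ be a fixed integer. In the preferential attachment graph process $\{G_{1,\delta}(t)\}_{t\ge 1}$, let $X(t)$ ($t\ge r$) be the number of descendants of vertex $r$ among the vertices $[t]$, and set $p(t):=X(t)/t$. Then almost surely $\lim_{t\to\infty}p(t)$ exists, and its distribution is the mixture of the beta distribution with parameters $a=1$, $b=r-\frac{1}{2+\delta}$ and the beta distribution with parameters $a=\frac{1+\delta}{2+\delta}$, $b=r$, with weights $\frac{1+\delta}{(2+\delta)r-1}$ and $\frac{(2+\delta)(r-1)}{(2+\delta)r-1}$ respectively. Consequently, almost surely $\liminf_{t\to\infty}p(t)>0$.
   Context: Preferential attachment process $\{G_{m,\delta}(t)\}_{t\ge1}$ (integer $m\ge1$, real $\delta\ge -m$): $G_{m,\delta}(1)$ is vertex $1$ with $m$ loops (a loop contributes $2$ to the degree). For $t\ge 1$, $G_{m,\delta}(t+1)$ is obtained by adding vertex $t+1$ and $m$ edges from it, one at a time: for $i=1,\dots,m$, with $d_{t,i-1}(x)$ the degree of $x$ just before the $i$-th edge of $t+1$ is added (so $d_{t,0}(t+1)=0$), the other endpoint $w$ of the $i$-th edge satisfies $\mathbb P(w=x)=\frac{d_{t,i-1}(x)+\delta}{(2m+\delta)t+2i-1+i\delta/m}$ for $x\in[t]$ and $\mathbb P(w=t+1)=\frac{d_{t,i-1}(t+1)+1+i\delta/m}{(2m+\delta)t+2i-1+i\delta/m}$ (a loop). Descendants of a fixed vertex $r$: $r$ is a descendant of itself; a vertex $x>r$ is a descendant of $r$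 iff at least one of the edges added with $x$ at step $x$ goes to a vertex $y<x$ that is a descendant of $r$ (equivalently, there is a path from $x$ to $r$ along which vertex labels strictly decrease). The beta distribution with parameters $a,b>0$ has density $\frac{\Gamma(a+b)}{\Gamma(a)\Gamma(b)}x^{a-1}(1-x)^{b-1}$ on $(0,1)$. *)

(* Defs.v *)
From HB Require Import structures.
From mathcomp Require Export all_boot all_order all_algebra.
From mathcomp Require Export all_classical all_reals all_analysis.

Set Implicit Arguments.
Unset Strict Implicit.
Unset Printing Implicit Defensive.

Import Order.TTheory GRing.Theory Num.Theory.
Import numFieldNormedType.Exports.

Local Open Scope classical_set_scope.
Local Open Scope ring_scope.

(* A multigraph on positive labels is the list of its edges, in order of      *)
(* insertion; [(v, y)] is an edge added together with vertex [v], with other  *)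
(* endpoint [y].                                                              *)
Definition multigraph := seq (nat * nat).

(* A loop [(x, x)] counts twice. *)
Definition degree (g : multigraph) (x : nat) : nat :=
  (\sum_(e <- g) ((e.1 == x) + (e.2 == x)))%N.

(* [w v j] is the other endpoint of the [j]-th edge (1 <= j <= m) of vertex   *)
(* [v]. The result consists of all the edges of the vertices 1, ..., t        *)
(* followed by the first [k] edges of vertex t + 1.                           *)
Definition pa_partial (m : nat) (w : nat -> nat -> nat) (t k : nat)
    : multigraph :=
  [seq (v, w v j) | v <- iota 1 t, j <- iota 1 m] ++
  [seq (t.+1, w t.+1 j) | j <- iota 1 k].

Definition pa_graph (m : nat) (w : nat -> nat -> nat) (t : nat) : multigraph :=
  pa_partial m w t 0.

Definition pa_norm (R : realType) (m : nat) (delta : R) (t i : nat) : R :=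
  (2 * m%:R + delta) * t%:R + 2 * i%:R - 1 + i%:R * delta / m%:R.

(* The attachment probabilities are conditional on the whole past, that is on *)
(* the value [g] of the list of edges present just before the [i]-th edge of  *)
(* vertex t + 1 is added. They sum to 1 over x in [t + 1], so no other        *)
(* endpoint has positive probability.                                         *)
Record pa_process (d : measure_display) (T : measurableType d) (R : realType)
    (P : probability T R) (m : nat) (delta : R)
    (w : nat -> nat -> {RV P >-> nat}) : Prop := PAProcess {
  pa_init : forall (j : nat) (omega : T),
    (1 <= j <= m)%N -> w 1%N j omega = 1%N ;
  pa_attach : forall (t i : nat) (g : multigraph) (x : nat),
    (1 <= t)%N -> (1 <= i <= m)%N -> (1 <= x <= t)%N ->
    let past :=
      [set omega | pa_partial m (fun v j => w v j omega) t i.-1 = g] in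
    P (past `&` [set omega | w t.+1 i omega = x]) =
    (P past * (((degree g x)%:R + delta) / pa_norm m delta t i)%:E)%E ;
  pa_loop : forall (t i : nat) (g : multigraph),
    (1 <= t)%N -> (1 <= i <= m)%N ->
    let past :=
      [set omega | pa_partial m (fun v j => w v j omega) t i.-1 = g] in
    P (past `&` [set omega | w t.+1 i omega = t.+1]) =
    (P past * (((degree g t.+1)%:R + 1 + i%:R * delta / m%:R)
               / pa_norm m delta t i)%:E)%E }.

Inductive descendant (g : multigraph) (r : nat) : nat -> Prop :=
| descendant_root : descendant g r r
| descendant_step (x y : nat) : (r < x)%N -> (x, y) \in g -> (y < x)%N ->
    descendant g r y -> descendant g r x.

Definition num_descendants (g : multigraph) (r t : nat) : nat :=
  count (fun x => `[< descendant g r x >]) (iota 1 t).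

Definition pa_descendants (m : nat) (w : nat -> nat -> nat) (r t : nat) : nat :=
  num_descendants (pa_graph m w t) r t.

Definition Gamma (R : realType) (a : R) : R :=
  \int[lebesgue_measure]_(x in `]0, +oo[) (x `^ (a - 1) * expR (- x)).

(* The library's [beta_pdf] and [beta_prob] only cover integer parameters. *)
Definition beta_density (R : realType) (a b x : R) : R :=
  Gamma (a + b) / (Gamma a * Gamma b) * x `^ (a - 1) * (1 - x) `^ (b - 1).

Definition beta_law (R : realType) (a b : R) (A : set R) : \bar R :=
  (\int[lebesgue_measure]_(x in A `&` `]0%R, 1%R[) (beta_density a b x)%:E)%E.

(* Main.v *)
(* Write [theta = 1 / (2 + delta)]. Every descendant of [r] other than [r]    *)
(* brings one edge with both ends among the descendants, so the total degree  *)
(* of the [X] descendants is [2 X - 1], plus one if [r] starts with a loop.   *)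
(* Hence vertex [t + 1] is a descendant with conditional probability [Y / (t  *)
(* + 1 - theta)], where [Y = X], respectively [Y = X - theta] when [r] has no *)
(* loop: this is a Polya urn. The ratio is a martingale with orthogonal       *)
(* increments of order [1 / t], so its increments along the times [n ^ 4] are *)
(* almost surely summable; [X] is nondecreasing and these times have ratios   *)
(* tending to 1, so [X / t] converges. Ratios of rising factorials [Y ... (Y  *)
(* + k - 1) / ((t + 1 - theta) ... (t + k - theta))] are martingales too and  *)
(* converge to the [k]-th power of the limit, so the moments of the limit are *)
(* those of the mixture of beta laws. A law on [[0, 1]] is determined by its  *)
(* moments (Bernstein polynomials). Each of the two beta laws has an integer  *)
(* parameter, so its moments only require the functional equation of [Gamma]. *)
From HB Require Import structures.
Require Import Defs.
From mathcomp Require Import all_boot all_order all_algebra.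
From mathcomp Require Import all_classical all_reals all_analysis.
From mathcomp Require Import measurable_realfun ring lra zify.

Set Implicit Arguments.
Unset Strict Implicit.
Unset Printing Implicit Defensive.

Import Order.TTheory GRing.Theory Num.Theory.
Import numFieldNormedType.Exports.

Local Open Scope classical_set_scope.
Local Open Scope ring_scope.

(** * Improper integrals and the Gamma function *)

(** For [t >= r], vertex [t + 1] descends from [r] exactly when its single edge lands among the
    present descendants. Their total degree is determined by their number and by whether [r] carries
    a loop ([sum_degree_descendants]). So [urn_mass] and [urn_total] form a Polya urn: the total
    grows by one at each step, and the mass grows by one with probability mass over total
    ([sum_attach_prob_descendants]). At time [r] the mass is [1] if [r] has a loop and [1 - theta]
    otherwise, which gives the two weights ([urn_moment_root]); the total is [1 + b = a + r], which
    gives the parameters [(1, b)] and [(a, r)].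

    The urn is used twice. The fraction mass over total is a martingale with small orthogonal
    increments ([urn_frac_increment]); hence it converges almost surely along fourth powers and, the
    number of descendants being monotone, the proportion converges along all times ([cvg_quartic],
    [proportion_cvg_ae]). Ratios of rising factorials are bounded martingales
    ([urn_moment_martingale]) that tend to powers of the limit, so dominated convergence gives every
    moment of the limit ([proportion_limit_moment]). These are the moments of the beta mixture
    ([beta_moment_1l], [beta_moment_natr]), and moments determine a law on the unit interval
    ([moments_eq_tail], [law_of_moments]). The mixture has a density on []0, 1[], so the limit is
    almost surely positive, and with it the liminf.

    Probabilities enter through finite sums only: [pa_expect] is a recursively defined expectation
    over the finitely many histories, and [integral_pa_history] identifies it with the integral
    against [P]. *)

Section rising_factorial.
Variable R : realType.

Definition rising (a : R) (k : nat) : R := \prod_(i < k) (a + i%:R).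

Lemma rising0 a : rising a 0 = 1.
Proof. by rewrite /rising big_ord0. Qed.

Lemma risingS a k : rising a k.+1 = rising a k * (a + k%:R).
Proof. by rewrite /rising big_ord_recr. Qed.

Lemma risingSl a k : rising a k.+1 = a * rising (a + 1) k.
Proof.
rewrite /rising big_ord_recl addr0; congr (_ * _); apply: eq_bigr => i _.
by rewrite /= /bump/= natrD addrA.
Qed.

Lemma risingD a m n : rising a (m + n) = rising a m * rising (a + m%:R) n.
Proof.
elim: n => [|n ih]; first by rewrite addn0 rising0 mulr1.
by rewrite addnS !risingS ih natrD addrA mulrA.
Qed.

Lemma rising_gt0 a k : 0 < a -> 0 < rising a k.
Proof. by move=> a0; apply: prodr_gt0 => i _; rewrite ltr_wpDr. Qed.

Lemma rising1 k : rising 1 k = k`!%:R.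
Proof.
elim: k => [|k ih]; first by rewrite rising0 fact0.
by rewrite risingS ih factS natrM mulrC nat1r.
Qed.

End rising_factorial.

Section improper_integrals.
Variable R : realType.
Local Notation mu := (@lebesgue_measure R).

Lemma integral_itvcc_derive (F f : R -> R) (a b : R) : a < b ->
    {in `[a, b], forall x, is_derive (x : R) (1 : R) F (f x)} ->
    {in `[a, b], continuous f} ->
  (\int[mu]_(x in `[a, b]) (f x)%:E = (F b - F a)%:E)%E.
Proof.
move=> ab dF cf.
have cF x : x \in `[a, b] -> {for x, continuous F}.
  move=> xab; apply: differentiable_continuous; apply/derivable1_diffP.
  by have [] := dF _ xab.
rewrite (@continuous_FTC2 _ f F)//.
- apply: continuous_in_subspaceT => x; rewrite inE => xab; exact: cf.
- split.
  + move=> x xab; have [] // := dF x.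
    exact: subset_itv_oo_cc xab.
  + by apply: cvg_at_right_filter; apply: cF; rewrite in_itv/= lexx ltW.
  + by apply: cvg_at_left_filter; apply: cF; rewrite in_itv/= lexx ltW.
- move=> x xab; have xab' : x \in `[a, b] by exact: subset_itv_oo_cc xab.
  by have := dF x xab' => ?; rewrite derive1E derive_val.
Qed.

Lemma continuous_powR (a x : R) : 0 < x -> {for x, continuous (fun y : R => y `^ a)}.
Proof.
move=> l0; apply: differentiable_continuous; apply/derivable1_diffP.
by apply: derivable_powR; rewrite in_itv/= l0.
Qed.

Lemma cvg_powR_n (a : R) (u : R^nat) (l : R) : 0 < l ->
  u n @[n --> \oo] --> l -> u n `^ a @[n --> \oo] --> l `^ a.
Proof.
move=> l0 ul.
by apply: (@cvg_comp _ _ _ u (fun x : R => x `^ a) _ _ _ ul); exact: continuous_powR.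
Qed.

(** Monotone convergence along compact intervals that avoid the possible singularity at 0, so that
    the fundamental theorem of calculus applies on each of them. *)
Lemma integral_itv0y_cvg (f : R -> R) :
    measurable_fun `](0 : R), +oo[ f -> (forall x, 0 < x -> 0 <= f x) ->
  (\int[mu]_(x in `[harmonic n.+1, n.+2%:R]) (f x)%:E)%E @[n --> \oo]
    --> (\int[mu]_(x in `]0%R, +oo[) (f x)%:E)%E.
Proof.
move=> mf f0.
pose F n : set R := [set` `[@harmonic R n.+1, n.+2%:R]].
have FE : \bigcup_n F n = [set` `]0%R, +oo[].
  apply/seteqP; split => x/=.
    move=> [n _]; rewrite /F/= !in_itv/= andbT => /andP[+ _].
    by apply: lt_le_trans; rewrite invr_gt0.
  rewrite in_itv/= andbT => x0.
  pose n := Num.bound (Num.max x x^-1).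
  have xn : Num.max x x^-1 < n%:R.
    apply: archi_boundP; rewrite le_max (ltW x0)//.
  exists n => //; rewrite /F/= in_itv/=; apply/andP; split.
    rewrite -(invrK x) lef_pV2 ?posrE ?invr_gt0//.
    apply: (@le_trans _ _ n%:R); last by rewrite ler_nat ltnW// ltnW.
    by apply: le_trans (ltW xn); rewrite le_max lexx orbT.
  apply: (@le_trans _ _ n%:R); last by rewrite ler_nat ltnW// ltnW.
  by apply: le_trans (ltW xn); rewrite le_max lexx.
have FS n : F n `<=` [set` `]0%R, +oo[] by rewrite -FE; exact: bigcup_sup.
rewrite -FE; apply: (@ge0_nondecreasing_set_cvg_integral _
  (measurableTypeR R) R F (EFin \o f) mu).
- apply/nondecreasing_seqP => n; rewrite subsetEset /F; apply: subset_itv.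
    by rewrite bnd_simp lef_pV2 ?posrE// ler_nat.
  by rewrite bnd_simp ler_nat.
- by move=> n; exact: measurable_itv.
- by move=> n; apply/measurable_EFinP; apply: measurable_funS mf.
- by move=> n x /FS/=; rewrite in_itv/= andbT => /f0.
Qed.

Lemma integral_itv01_cvg (f : R -> R) :
    measurable_fun `](0 : R), 1[ f -> (forall x, 0 < x < 1 -> 0 <= f x) ->
  (\int[mu]_(x in `[harmonic n.+2, (1 - harmonic n.+2)%R]) (f x)%:E)%E @[n --> \oo]
    --> (\int[mu]_(x in `]0%R, 1%R[) (f x)%:E)%E.
Proof.
move=> mf f0.
(* The offset puts the left end at [1 / (n + 3)], below one half, so no interval is degenerate. *)
pose F n : set R := [set` `[@harmonic R n.+2, 1 - harmonic n.+2]].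
have FE : \bigcup_n F n = [set` `]0%R, 1%R[].
  apply/seteqP; split => x/=.
    move=> [n _]; rewrite /F/= !in_itv/= => /andP[h1 h2].
    have h0 : 0 < n.+3%:R^-1 :> R by rewrite invr_gt0.
    by rewrite (lt_le_trans h0 h1)/= (le_lt_trans h2)// ltrBlDr ltrDl.
  rewrite in_itv/= => /andP[x0 x1].
  have y0 : 0 < 1 - x by rewrite subr_gt0.
  pose n := Num.bound (Num.max x^-1 (1 - x)^-1).
  have xn : Num.max x^-1 (1 - x)^-1 < n%:R.
    by apply: archi_boundP; rewrite le_max invr_ge0 (ltW x0).
  exists n => //; rewrite /F/= in_itv/=; apply/andP; split.
    rewrite -[leRHS]invrK lef_pV2 ?posrE ?invr_gt0//.
    apply: (@le_trans _ _ n%:R); last by rewrite ler_nat ltnW// ltnW// ltnW.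
    by apply: le_trans (ltW xn); rewrite le_max lexx.
  rewrite lerBrDl -lerBrDr -[leRHS]invrK lef_pV2 ?posrE ?invr_gt0//.
  apply: (@le_trans _ _ n%:R); last by rewrite ler_nat ltnW// ltnW// ltnW.
  by apply: le_trans (ltW xn); rewrite le_max lexx orbT.
have FS n : F n `<=` [set` `]0%R, 1%R[] by rewrite -FE; exact: bigcup_sup.
rewrite -FE; apply: (@ge0_nondecreasing_set_cvg_integral _
  (measurableTypeR R) R F (EFin \o f) mu).
- apply/nondecreasing_seqP => n; rewrite subsetEset /F; apply: subset_itv.
    by rewrite bnd_simp lef_pV2 ?posrE// ler_nat.
  by rewrite bnd_simp lerD2l lerN2 lef_pV2 ?posrE// ler_nat.
- by move=> n; exact: measurable_itv.
- by move=> n; apply/measurable_EFinP; apply: measurable_funS mf.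
- by move=> n x /FS/=; rewrite in_itv/= => /f0.
Qed.

Lemma cvg_harmonic_shift k : @harmonic R (k + n)%N @[n --> \oo] --> 0.
Proof.
have := @cvg_shiftn k R harmonic (nbhs 0).
under eq_fun do rewrite addnC.
move=> h; suff : (harmonic : R^nat) x @[x --> \oo] --> (0 : R) by rewrite -h.
exact: cvg_harmonic.
Qed.

Lemma harmonic_lt k : @harmonic R k.+2 < 1 - harmonic k.+2.
Proof.
suff : @harmonic R k.+2 < 2^-1 by set h := harmonic _; lra.
by rewrite ltf_pV2 ?posrE// ltr_nat.
Qed.

(** The antiderivative is [x ^ a / a]; for [a < 1] the integrand blows up at 0, hence the passage
    through compact intervals. *)
Lemma integral_powR01 (a : R) : 0 < a ->
  (\int[mu]_(x in `]0%R, 1%R[) (x `^ (a - 1))%:E = (a^-1)%:E)%E.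
Proof.
move=> a0; pose F (x : R) := a^-1 * x `^ a.
have mf : measurable_fun `](0 : R), 1[ (fun x : R => x `^ (a - 1)).
  by apply: measurable_funTS; exact: measurable_powR.
apply: cvg_unique (integral_itv01_cvg mf _) _; first exact: ereal_hausdorff.
  by move=> x _; rewrite powR_ge0.
rewrite /= [X in X @ _ --> _](_ : _ = fun n =>
    (F (1 - harmonic n.+2) - F (harmonic n.+2))%:E); last first.
  apply/funext => n.
  rewrite (@integral_itvcc_derive F)//.
  - exact: harmonic_lt.
  - move=> x; rewrite in_itv/= => /andP[x0 _].
    have {}x0 : 0 < x by apply: lt_le_trans x0; rewrite invr_gt0.
    have := @is_derive1_powR R a x x0 => ?.
    have -> : F = a^-1 *: (fun x : R => x `^ a) by [].
    apply: is_derive_eq; rewrite /GRing.scale/=.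
    by rewrite mulrA mulVf ?mul1r// gt_eqF.
  - move=> x; rewrite in_itv/= => /andP[x0 _]; apply: continuous_powR.
    by apply: lt_le_trans x0; rewrite invr_gt0.
apply: cvg_EFin; first by apply: nearW.
rewrite (_ : a^-1 = a^-1 * 1 `^ a - a^-1 * 0); last first.
  by rewrite powR1 mulr0 mulr1 subr0.
apply: cvgB; apply: cvgMr.
  apply: cvg_powR_n => //.
  rewrite -[X in _ --> X]subr0; apply: cvgB; first exact: cvg_cst.
  exact: (@cvg_harmonic_shift 2).
have /cvg_at_rightP := powR_cvg0 a0; apply; split => [n|].
  by rewrite invr_gt0.
exact: (@cvg_harmonic_shift 2).
Qed.

Lemma integral_powR01_onem (b : R) : 0 < b ->
  (\int[mu]_(x in `]0%R, 1%R[) ((1 - x) `^ (b - 1))%:E = (b^-1)%:E)%E.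
Proof.
move=> b0; pose F (x : R) := - b^-1 * (1 - x) `^ b.
have mf : measurable_fun `](0 : R), 1[ (fun x : R => (1 - x) `^ (b - 1)).
  apply: measurable_funTS.
  have := measurableT_comp (measurable_powR (b - 1)); apply.
  exact: measurable_funB.
apply: cvg_unique (integral_itv01_cvg mf _) _; first exact: ereal_hausdorff.
  by move=> x _; rewrite powR_ge0.
rewrite /= [X in X @ _ --> _](_ : _ = fun n =>
    (F (1 - harmonic n.+2) - F (harmonic n.+2))%:E); last first.
  apply/funext => n.
  rewrite (@integral_itvcc_derive F (fun x => (1 - x) `^ (b - 1)))//.
  - exact: harmonic_lt.
  - move=> x; rewrite in_itv/= => /andP[_ x1].
    have {}x1 : 0 < 1 - x.
      by rewrite subr_gt0 (le_lt_trans x1)// ltrBlDr ltrDl invr_gt0.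
    have := @is_derive1_powR R b (1 - x) x1 => h.
    have -> : F =
      (- b^-1) *: ((fun x : R => x `^ b) \o (fun x : R => 1 - x)) by [].
    apply: is_derive_eq; rewrite /GRing.scale/=.
    by field; rewrite gt_eqF.
  - move=> x; rewrite in_itv/= => /andP[_ x1].
    have {}x1 : 0 < 1 - x.
      by rewrite subr_gt0 (le_lt_trans x1)// ltrBlDr ltrDl invr_gt0.
    apply: (@continuous_comp _ _ _ (fun x : R => 1 - x) (fun x : R => x `^ (b - 1))).
      by apply: continuousB; [exact: cst_continuous|].
    exact: continuous_powR.
apply: cvg_EFin; first by apply: nearW.
rewrite (_ : b^-1 = - b^-1 * 0 - - b^-1 * (1 - 0) `^ b); last first.
  by rewrite subr0 powR1 mulr0 mulr1 sub0r opprK.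
apply: cvgB; apply: cvgMr.
  under eq_fun do rewrite subKr.
  have /cvg_at_rightP := powR_cvg0 b0; apply; split => [n|].
    by rewrite invr_gt0.
  exact: (@cvg_harmonic_shift 2).
apply: cvg_powR_n; first by rewrite subr0.
apply: cvgB; first exact: cvg_cst.
exact: (@cvg_harmonic_shift 2).
Qed.

End improper_integrals.

Section gamma_function.
Variable R : realType.
Local Notation mu := (@lebesgue_measure R).
Local Notation gamma_integral a :=
  (\int[mu]_(x in `]0%R, +oo[) (x `^ (a - 1) * expR (- x))%:E)%E.

Lemma measurable_gamma_integrand (a : R) D :
  measurable_fun D (fun x : R => x `^ (a - 1) * expR (- x)).
Proof.
apply: measurable_funTS; apply: measurable_funM; first exact: measurable_powR.
apply: (@measurableT_comp _ _ _ _ _ _ expR); first exact: measurable_expR.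
exact: measurable_funN.
Qed.

Lemma gamma_integrand_ge0 (a x : R) : 0 <= x `^ (a - 1) * expR (- x).
Proof. by rewrite mulr_ge0 ?powR_ge0 ?expR_ge0. Qed.

(** For a natural [k >= a], the bound [expR x >= 1 + x ^ (k + 1) / (k + 1)!] leaves at most
    [(k + 1)! / x]. *)
Lemma powR_expRN_cvg0 (a : R) :
  n.+2%:R `^ a * expR (- n.+2%:R) @[n --> \oo] --> (0 : R).
Proof.
pose k := Num.bound `|a|.
have ak : a <= k%:R.
  by rewrite (le_trans (ler_norm a))// ltW// archi_boundP.
apply: (@squeeze_cvgr nat \oo _ R (cst 0)
  (fun n => (k.+1)`!%:R * harmonic (1 + n)%N)
  (fun n => n.+2%:R `^ a * expR (- n.+2%:R))).
- apply: nearW => n; apply/andP; split.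
    by rewrite mulr_ge0 ?powR_ge0 ?expR_ge0.
  have n0 : 0 < n.+2%:R :> R by [].
  rewrite expRN ler_pdivrMr ?expR_gt0//.
  have h := expR_ge1Dxn k (ltW n0).
  apply: (@le_trans _ _ (n.+2%:R ^+ k)).
    by rewrite -powR_mulrn// ler_powR// ler1n.
  apply: (@le_trans _ _ (k.+1`!%:R * harmonic (1 + n)%N * (n.+2%:R ^+ k.+1 / k.+1`!%:R))).
    rewrite le_eqVlt; apply/orP; left; apply/eqP.
    rewrite /= exprS; field.
    by rewrite !nat1r !pnatr_eq0 -lt0n fact_gt0.
  apply: ler_wpM2l; first by rewrite mulr_ge0// invr_ge0.
  by apply: le_trans h; rewrite lerDr.
- exact: cvg_cst.
- rewrite -[X in _ --> X](mulr0 (k.+1`!%:R : R)); apply: cvgMr.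
  exact: (@cvg_harmonic_shift R 1).
Qed.

(** Integration by parts: the derivative of [x ^ a * expR (- x)] is integrated over compact
    intervals, and the boundary terms vanish in the limit. The identity is stated in the extended
    reals because finiteness is derived from it later. *)
Lemma gamma_integralS (a : R) : 0 < a ->
  gamma_integral (a + 1) = (a%:E * gamma_integral a)%E.
Proof.
move=> a0; pose F (x : R) := x `^ a * expR (- x).
pose g b (x : R) := x `^ (b - 1) * expR (- x).
have gc b (n : nat) : {in `[@harmonic R n.+1, n.+2%:R], continuous (g b)}.
  move=> x; rewrite in_itv/= => /andP[x0 _].
  have {}x0 : 0 < x by apply: lt_le_trans x0; rewrite invr_gt0.
  apply: (@continuousM _ _ (fun x : R => x `^ (b - 1)) (expR \o -%R)).
    exact: continuous_powR.
  apply: continuous_comp; first exact: continuousN.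
  exact: continuous_expR.
have ab (n : nat) : @harmonic R n.+1 < n.+2%:R.
  by rewrite (@lt_le_trans _ _ 1)// ?ler1n// invf_lt1// ltr1n.
have gi b (n : nat) : mu.-integrable [set` `[@harmonic R n.+1, n.+2%:R]] (EFin \o g b).
  apply: continuous_compact_integrable; first exact: segment_compact.
  by apply: continuous_in_subspaceT => x; rewrite inE => xab; exact: (gc b n).
have step n : (\int[mu]_(x in `[harmonic n.+1, n.+2%:R]) (g (a + 1)%R x)%:E =
    (F (harmonic n.+1) - F n.+2%:R)%:E +
    a%:E * \int[mu]_(x in `[harmonic n.+1, n.+2%:R]) (g a x)%:E)%E.
  have := @integral_itvcc_derive R F (fun x => a * g a x - g (a + 1) x) _ _ (ab n).
  move=> /(_ _ _)/wrap[].
    move=> x; rewrite in_itv/= => /andP[x0 _].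
    have {}x0 : 0 < x by apply: lt_le_trans x0; rewrite invr_gt0.
    have := @is_derive1_powR R a x x0 => h.
    have -> : F = (fun x : R => x `^ a) * (expR \o -%R) by [].
    apply: is_derive_eq; rewrite /GRing.scale/= /g addrK.
    by ring.
    by move=> x xab; apply: cvgB; [apply: cvgMr|]; exact: (gc _ n x xab).
  under eq_integral do rewrite EFinB EFinM.
  rewrite integralB//; last 2 first.
  - by apply: (@integrableZl _ _ _ _ _ _ _ _ (gi a n)).
  - exact: gi.
  rewrite integralZl//; last exact: gi.
  have fin b : (\int[mu]_(x in `[harmonic n.+1, n.+2%:R]) (g b x)%:E)%E \is a fin_num.
    by apply: integrable_fin_num => //; exact: gi.
  rewrite -(fineK (fin a)) -(fineK (fin (a + 1))); set A := fine _; set B := fine _.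
  by rewrite -!EFinM -EFinB -EFinD => -[AB]; congr EFin; lra.
have g0 b (x : R) : 0 < x -> 0 <= g b x by move=> _; exact: gamma_integrand_ge0.
have mg b : measurable_fun `](0 : R), +oo[ (g b) by exact: measurable_gamma_integrand.
have C1 := integral_itv0y_cvg (mg (a + 1)) (g0 (a + 1)).
have C2 := integral_itv0y_cvg (mg a) (g0 a).
rewrite -[RHS]add0e.
apply: cvg_unique C1 _; first exact: ereal_hausdorff.
rewrite /=; under eq_fun do rewrite step.
apply: cvgeD.
- by rewrite fin_num_adde_defr.
- apply: cvg_EFin; first exact: nearW.
  rewrite -[X in _ --> X]subr0; apply: cvgB; last exact: powR_expRN_cvg0.
  rewrite -[X in _ --> X](mul0r (expR (- 0))); apply: cvgM.
    have /cvg_at_rightP := powR_cvg0 a0; apply; split => [n|].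
      by rewrite invr_gt0.
    exact: (@cvg_harmonic_shift R 1).
  apply: (@cvg_comp _ _ _ _ expR _ (nbhs (- 0 : R))); last exact: continuous_expR.
  by apply: cvgN; exact: (@cvg_harmonic_shift R 1).
- by apply: cvgeZl.
Qed.

(** The integrand is the density of the exponential law of rate 1. *)
Lemma gamma_integral1 : gamma_integral 1 = 1%E.
Proof.
have h := @integral_exponential_pdf R 1 ltr01.
rewrite -h -[in RHS](setUv `]0%R, +oo[%classic) ge0_integral_setU//=; last 4 first.
- exact: measurableC.
- rewrite setUv; apply/measurable_EFinP; exact: measurable_exponential_pdf.
- by move=> x _; rewrite lee_fin exponential_pdf_ge0.
- exact/disj_setPCl.
rewrite [X in (_ + X)%E](_ : _ = 0%E) ?adde0.
  apply: eq_integral => x; rewrite inE/= in_itv/= andbT => x0.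
  by rewrite subrr powRr0 mul1r exponential_pdfE ?ltW// mul1r mulN1r.
rewrite (_ : ~` _ = [set` `]-oo, (0 : R)]]); last first.
  by apply/seteqP; split => x/=; rewrite !in_itv/= andbT leNgt => /negP.
rewrite -(@integral_itv_bndo_bndc _ _ _ (EFin \o exponential_pdf 1)); last first.
  by apply/measurable_EFinP/measurable_funTS; exact: measurable_exponential_pdf.
apply: integral0_eq => x/=; rewrite in_itv/= => x0.
by rewrite lt0_exponential_pdf.
Qed.

(** The integrand is dominated by [x ^ (a - 1)] below 1 and by [expR (- x)] above 1. *)
Lemma gamma_integral_lty (a : R) : 0 < a <= 1 -> (gamma_integral a < +oo)%E.
Proof.
move=> /andP[a0 a1].
have -> : [set` `](0 : R), +oo[] = [set` `](0 : R), 1[] `|` [set` `[(1 : R), +oo[].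
  apply/seteqP; split => x/=; rewrite !in_itv/= !andbT.
    by move=> x0; have [x1|x1] := ltP x 1; [left; rewrite x0|right].
  by move=> [/andP[]//|]; exact: lt_le_trans.
rewrite ge0_integral_setU//=; last 3 first.
- by apply/measurable_EFinP; exact: measurable_gamma_integrand.
- by move=> x _; rewrite lee_fin gamma_integrand_ge0.
- rewrite disj_set2E; apply/eqP/seteqP; split => x//=.
  by rewrite !in_itv/= andbT => -[/andP[_ /lt_geF ->]].
apply: lte_add_pinfty.
  apply: (@le_lt_trans _ _ (\int[mu]_(x in `]0%R, 1%R[) (x `^ (a - 1))%:E)%E); last first.
    by rewrite integral_powR01// ltry.
  apply: ge0_le_integral => //.
  - by move=> x _; rewrite lee_fin gamma_integrand_ge0.
  - by apply/measurable_EFinP; exact: measurable_gamma_integrand.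
  - by apply/measurable_EFinP; apply: measurable_funTS; exact: measurable_powR.
  - move=> x /=; rewrite in_itv/= => /andP[x0 _].
    by rewrite lee_fin ler_piMr ?powR_ge0// expR_le1 oppr_le0 ltW.
apply: (@le_lt_trans _ _ (\int[mu]_(x in `[1%R, +oo[) (x `^ (1 - 1) * expR (- x))%:E)%E).
  apply: ge0_le_integral => //.
  - by move=> x _; rewrite lee_fin gamma_integrand_ge0.
  - by apply/measurable_EFinP; exact: measurable_gamma_integrand.
  - by apply/measurable_EFinP; exact: measurable_gamma_integrand.
  - move=> x /=; rewrite in_itv/= andbT => x1.
    by rewrite lee_fin ler_wpM2r ?expR_ge0// ler_powR// lerB.
apply: (@le_lt_trans _ _ (gamma_integral 1)); last by rewrite gamma_integral1 ltry.
apply: ge0_subset_integral => //.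
- by apply/measurable_EFinP; exact: measurable_gamma_integrand.
- by move=> x _; rewrite lee_fin gamma_integrand_ge0.
- by apply: subset_itvr; rewrite bnd_simp.
Qed.

Lemma gamma_integral_gt0 (a : R) : 0 < a -> (0 < gamma_integral a)%E.
Proof.
move=> a0.
apply: (@lt_le_trans _ _
    (\int[mu]_(x in `]0%R, 1%R[) ((expR (- 1))%:E * (x `^ (a - 1))%:E))%E).
  rewrite ge0_integralZl//=.
  - by rewrite integral_powR01// -EFinM lte_fin mulr_gt0 ?expR_gt0 ?invr_gt0.
  - by apply/measurable_EFinP; apply: measurable_funTS; exact: measurable_powR.
  - by move=> x _; rewrite lee_fin powR_ge0.
apply: (@le_trans _ _ (\int[mu]_(x in `]0%R, 1%R[) (x `^ (a - 1) * expR (- x))%:E)%E).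
  apply: ge0_le_integral => //.
  - by move=> x _; rewrite lee_fin mulr_ge0 ?powR_ge0 ?expR_ge0.
  - apply: measurable_funeM; apply/measurable_EFinP; apply: measurable_funTS.
    exact: measurable_powR.
  - by apply/measurable_EFinP; exact: measurable_gamma_integrand.
  - move=> x /=; rewrite in_itv/= => /andP[x0 x1].
    by rewrite -EFinM lee_fin mulrC ler_wpM2l ?powR_ge0// ler_expR lerN2 ltW.
apply: ge0_subset_integral => //.
- by apply/measurable_EFinP; exact: measurable_gamma_integrand.
- by move=> x _; rewrite lee_fin gamma_integrand_ge0.
- by apply: subset_itvl; rewrite bnd_simp.
Qed.

(** Every positive real is [a + n] with [0 < a <= 1]; the functional equation carries finiteness
    from the base interval upwards. Arguments of [Gamma] keep this form from here on. *)
Lemma gamma_integral_fin_num (a : R) n : 0 < a <= 1 ->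
  gamma_integral (a + n%:R) \is a fin_num.
Proof.
move=> a01; have /andP[a0 _] := a01.
elim: n => [|n ih].
  by rewrite addr0 gt0_fin_numE ?gamma_integral_gt0// gamma_integral_lty.
rewrite -natr1 addrA gamma_integralS; last by rewrite ltr_wpDr.
by rewrite fin_numM.
Qed.

Lemma GammaE (a : R) : Gamma a = fine (gamma_integral a).
Proof. by []. Qed.

Lemma GammaS (a : R) n : 0 < a <= 1 ->
  Gamma (a + n.+1%:R) = (a + n%:R) * Gamma (a + n%:R).
Proof.
move=> a01; have /andP[a0 _] := a01.
rewrite !GammaE -natr1 addrA gamma_integralS; last by rewrite ltr_wpDr.
by rewrite fineM// gamma_integral_fin_num.
Qed.

Lemma Gamma_gt0 (a : R) n : 0 < a <= 1 -> 0 < Gamma (a + n%:R).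
Proof.
move=> a01; have /andP[a0 _] := a01.
rewrite GammaE fine_gt0// gamma_integral_gt0 ?ltr_wpDr//=.
by rewrite -ge0_fin_numE ?gamma_integral_fin_num// ltW// gamma_integral_gt0 ?ltr_wpDr.
Qed.

Lemma Gamma1 : Gamma (1 : R) = 1.
Proof. by rewrite GammaE gamma_integral1. Qed.

End gamma_function.

(** * Moments of beta laws *)

Section beta_moments.
Variable R : realType.
Local Notation mu := (@lebesgue_measure R).

(* Both [x `^ (a - 1)] with [u x = x] and [(1 - x) `^ (a - 1)] with           *)
(* [u x = 1 - x] are such families, so no reflection of the integral is       *)
(* needed.                                                                    *)
Lemma integral_exprM_family (h : R -> R -> R) (u : R -> R) :
    (forall a, 0 < a -> measurable_fun setT (h a)) -> measurable_fun setT u ->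
    (forall a x, 0 <= h a x) ->
    (forall x, 0 < x < 1 -> 0 <= u x <= 1) ->
    (forall a x, 0 < a -> 0 < x < 1 -> u x * h a x = h (a + 1) x) ->
    (forall a, 0 < a -> (\int[mu]_(x in `]0%R, 1%R[) (h a x)%:E = (a^-1)%:E)%E) ->
  forall n a, 0 < a ->
  (\int[mu]_(x in `]0%R, 1%R[) ((1 - u x) ^+ n * h a x)%:E
    = (n`!%:R / rising a n.+1)%:E)%E.
Proof.
move=> mh mu_ h0 u01 uh hint.
have mint n a : 0 < a ->
    measurable_fun `](0 : R), 1[ (fun x => (1 - u x) ^+ n * h a x).
  move=> a0; apply: measurable_funTS; apply: measurable_funM; last exact: mh.
  by apply: measurable_funX; apply: measurable_funB.
have int0 n a x : 0 < x < 1 -> 0 <= (1 - u x) ^+ n * h a x.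
  by move=> /u01/andP[_ u1]; rewrite mulr_ge0// exprn_ge0// subr_ge0.
elim=> [|n ih] a a0.
  under eq_integral do rewrite expr0 mul1r.
  by rewrite hint// risingS rising0 addr0 !mul1r.
have a10 : 0 < a + 1 by rewrite addr_gt0.
have integ b : 0 < b -> mu.-integrable [set` `](0 : R), 1[]
    (fun x => ((1 - u x) ^+ n * h b x)%:E).
  move=> b0; apply/integrableP; split; first by apply/measurable_EFinP; exact: mint.
  under eq_integral => x.
    rewrite inE/= in_itv/= => x01; rewrite ger0_norm ?int0//.
    over.
  by rewrite ih// ltry.
(* One factor [1 - u x] is expanded; [u x] is absorbed by [h], whose parameter goes from [a] to
   [a + 1]. *)
transitivity (\int[mu]_(x in `]0%R, 1%R[)
    (((1 - u x) ^+ n * h a x)%:E - ((1 - u x) ^+ n * h (a + 1)%R x)%:E))%E.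
  apply: eq_integral => x; rewrite inE/= in_itv/= => x01.
  by rewrite -EFinB -uh// exprSr; congr EFin; ring.
rewrite integralB//; [|exact: integ|exact: integ].
rewrite !ih// -EFinB; congr EFin.
have r0 : rising (a + 1) n != 0 by rewrite gt_eqF// rising_gt0.
rewrite (risingSl a n.+1) risingSl !risingS factS natrM -!natr1.
field; rewrite r0 !gt_eqF//= -?addrA ?ltr_wpDr ?addr_ge0//.
Qed.

Lemma integral_powR_onemX (a : R) n : 0 < a ->
  (\int[mu]_(x in `]0%R, 1%R[) ((1 - x) ^+ n * x `^ (a - 1))%:E
    = (n`!%:R / rising a n.+1)%:E)%E.
Proof.
move: n a; apply: (@integral_exprM_family (fun a x => x `^ (a - 1)) id) => //.
- by move=> a x; rewrite powR_ge0.
- by move=> x /andP[/ltW -> /ltW ->].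
- by move=> a x a0 /andP[x0 _]; rewrite mulr_powRB1 ?addrK// ltW.
- exact: integral_powR01.
Qed.

Lemma integral_onem_powR_expr (b : R) k : 0 < b ->
  (\int[mu]_(x in `]0%R, 1%R[) (x ^+ k * (1 - x) `^ (b - 1))%:E
    = (k`!%:R / rising b k.+1)%:E)%E.
Proof.
move=> b0.
rewrite -(@integral_exprM_family (fun a x => (1 - x) `^ (a - 1)) (fun x => 1 - x))//.
- by under [RHS]eq_integral do rewrite subKr.
- move=> a _; apply: (@measurableT_comp _ _ _ _ _ _ (fun x : R => x `^ (a - 1))).
    exact: measurable_powR.
  exact: measurable_funB.
- exact: measurable_funB.
- by move=> a x; rewrite powR_ge0.
- by move=> x /andP[x0 x1]; rewrite subr_ge0 gerBl !ltW.
- by move=> a x a0 /andP[_ x1]; rewrite mulr_powRB1 ?addrK// subr_ge0 ltW.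
- exact: integral_powR01_onem.
Qed.

Lemma powRDn (a x : R) k : 0 < x -> x `^ (a + k%:R - 1) = x `^ (a - 1) * x ^+ k.
Proof.
move=> x0; rewrite addrAC (@powRD _ _ (a - 1)); last by rewrite (gt_eqF x0) implybT.
by rewrite powR_mulrn// ltW.
Qed.

Lemma Gamma_rising (a : R) n : 0 < a <= 1 -> Gamma (a + n%:R) = rising a n * Gamma a.
Proof.
move=> a01; elim: n => [|n ih]; first by rewrite addr0 rising0 mul1r.
by rewrite (GammaS n a01) ih risingS mulrCA mulrA.
Qed.

Lemma Gamma_nat n : Gamma (n.+1%:R : R) = n`!%:R.
Proof. by rewrite -nat1r Gamma_rising ?ltr01 ?lexx// Gamma1 mulr1 rising1. Qed.

(** With first parameter 1 the normalising constant is [Gamma (b + 1) / Gamma b = b]. *)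
Lemma beta_density_1l (c : R) n (x : R) : 0 < c <= 1 ->
  beta_density 1 (c + n%:R) x = (c + n%:R) * (1 - x) `^ (c + n%:R - 1).
Proof.
move=> c01; have G0 := Gamma_gt0 n c01.
rewrite /beta_density subrr powRr0 mulr1 Gamma1 mul1r addrC -addrA natr1 GammaS//.
by rewrite mulfK// gt_eqF.
Qed.

Lemma beta_density_natr (a : R) n (x : R) : 0 < a <= 1 -> x <= 1 ->
  beta_density a n.+1%:R x =
    rising a n.+1 / n`!%:R * x `^ (a - 1) * (1 - x) ^+ n.
Proof.
move=> a01 x1; have := Gamma_gt0 0 a01; rewrite addr0 => G0.
rewrite /beta_density Gamma_rising// Gamma_nat -[n.+1%:R]natr1 addrK.
rewrite powR_mulrn ?subr_ge0//; congr (_ * _ * _).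
by rewrite [_ * n`!%:R]mulrC invfM mulrA mulrAC mulfK// gt_eqF.
Qed.

Lemma beta_moment_1l (c : R) n k : 0 < c <= 1 ->
  (\int[mu]_(x in `]0%R, 1%R[) (x ^+ k * beta_density 1 (c + n%:R) x)%:E
    = (rising 1 k / rising (1 + (c + n%:R)) k)%:E)%E.
Proof.
move=> c01; have /andP[c0 _] := c01.
set b := c + n%:R; have b0 : 0 < b by rewrite ltr_wpDr.
under eq_integral do rewrite beta_density_1l// -/b mulrCA EFinM.
rewrite ge0_integralZl//=.
- rewrite integral_onem_powR_expr// -EFinM risingSl rising1 [1 + b]addrC.
  have r0 : rising (b + 1) k != 0 by rewrite gt_eqF// rising_gt0// addr_gt0.
  by congr EFin; field; rewrite r0 gt_eqF.
- apply/measurable_EFinP/measurable_funTS; apply: measurable_funM.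
    exact: measurable_funX.
  apply: (@measurableT_comp _ _ _ _ _ _ (fun x : R => x `^ (b - 1))).
    exact: measurable_powR.
  exact: measurable_funB.
- move=> x; rewrite in_itv/= => /andP[/ltW x0 _].
  by rewrite lee_fin mulr_ge0 ?exprn_ge0 ?powR_ge0.
- by rewrite lee_fin ltW.
Qed.

Lemma beta_moment_natr (a : R) n k : 0 < a <= 1 ->
  (\int[mu]_(x in `]0%R, 1%R[) (x ^+ k * beta_density a n.+1%:R x)%:E
    = (rising a k / rising (a + n.+1%:R) k)%:E)%E.
Proof.
move=> a01; have /andP[a0 _] := a01.
have ak0 : 0 < a + k%:R by rewrite ltr_wpDr.
transitivity (\int[mu]_(x in `]0%R, 1%R[)
    ((rising a n.+1 / n`!%:R)%:E * ((1 - x) ^+ n * x `^ (a + k%:R - 1))%:E))%E.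
  apply: eq_integral => x; rewrite inE/= in_itv/= => /andP[x0 x1].
  rewrite -EFinM; congr EFin; rewrite beta_density_natr//; last exact: ltW.
  by rewrite powRDn//; ring.
rewrite ge0_integralZl//=.
- rewrite integral_powR_onemX// -EFinM; congr EFin.
  have n0 : n`!%:R != 0 :> R by rewrite pnatr_eq0 -lt0n fact_gt0.
  have r1 : rising (a + k%:R) n.+1 != 0 by rewrite gt_eqF// rising_gt0.
  have r2 : rising (a + n.+1%:R) k != 0 by rewrite gt_eqF// rising_gt0// ltr_wpDr.
  rewrite mulrA divfK//.
  (* Both cross products are the rising factorial of [a] of length [n + 1 + k]. *)
  apply/eqP; rewrite eqr_div// -!risingD addnC//.
- apply/measurable_EFinP/measurable_funTS; apply: measurable_funM.
    by apply: measurable_funX; exact: measurable_funB.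
  exact: measurable_powR.
- move=> x; rewrite in_itv/= => /andP[_ /ltW x1].
  by rewrite lee_fin mulr_ge0 ?exprn_ge0 ?powR_ge0// subr_ge0.
- by rewrite lee_fin divr_ge0// ltW// rising_gt0.
Qed.

End beta_moments.

(** * Moment determinacy on the unit interval *)

Section bernstein.
Variable R : realType.
Implicit Types (x : R) (f g : nat -> R).

(* The expectation of [f N], [N] binomial with parameters [n] and [x],        *)
(* obtained by conditioning on the first trial.                               *)
Fixpoint bernstein (n : nat) f x : R :=
  if n is n'.+1 then
    (1 - x) * bernstein n' f x + x * bernstein n' (fun k => f k.+1) x
  else f 0%N.

Lemma bernsteinD n f g x :
  bernstein n (fun k => f k + g k) x = bernstein n f x + bernstein n g x.
Proof. by elim: n f g => [//|n ih] f g /=; rewrite !ih; ring. Qed.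

Lemma bernsteinZ n c f x : bernstein n (fun k => c * f k) x = c * bernstein n f x.
Proof. by elim: n f => [//|n ih] f /=; rewrite !ih; ring. Qed.

Lemma bernstein_cst n c x : bernstein n (fun=> c) x = c.
Proof. by elim: n => [//|n ih] /=; rewrite !ih; ring. Qed.

Lemma le_bernstein n f g x : 0 <= x <= 1 -> (forall k, f k <= g k) ->
  bernstein n f x <= bernstein n g x.
Proof.
move=> /andP[x0 x1]; elim: n f g => [|n ih] f g fg /=; first exact: fg.
by apply: lerD; apply: ler_wpM2l; rewrite ?subr_ge0//; exact: ih.
Qed.

(** Variance plus squared bias of a binomial variable. The centre [c] is arbitrary because
    conditioning on a success shifts it to [c - 1]. *)
Lemma bernstein_sqr n c x :
  bernstein n (fun k => (k%:R - c) ^+ 2) x = n%:R * x * (1 - x) + (n%:R * x - c) ^+ 2.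
Proof.
elim: n c => [|n ih] c /=; first by ring.
have -> : (fun k => (k.+1%:R - c) ^+ 2) = (fun k => (k%:R - (c - 1)) ^+ 2).
  by apply/funext => k; rewrite -natr1; ring.
by rewrite !ih -natr1; ring.
Qed.

(** Chebyshev's argument: a deviation [s] satisfies [|s| <= e] or [|s| <= s ^ 2 / e], so
    [|s| <= e + s ^ 2 / e] always, and the mean of [s ^ 2] is [x * (1 - x) / n]. *)
Lemma bernstein_lipschitz (F : R -> R) (L e : R) n x :
    (0 < n)%N -> 0 <= L -> 0 < e -> 0 <= x <= 1 ->
    (forall s t, `|F s - F t| <= L * `|s - t|) ->
  `|F x - bernstein n (fun k => F (k%:R / n%:R)) x| <= L * e + L / (e * n%:R).
Proof.
move=> n0 L0 e0 x01 HL; have /andP[x0 x1] := x01.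
have nr0 : 0 < n%:R :> R by rewrite ltr0n.
pose c := L / (e * n%:R ^+ 2).
have c0 : 0 <= c by rewrite divr_ge0// mulr_ge0 ?exprn_ge0 ?ltW.
have bnd k : `|F (k%:R / n%:R) - F x| <= L * e + c * (k%:R - n%:R * x) ^+ 2.
  apply: (le_trans (HL _ _)).
  set s := k%:R / n%:R - x.
  have -> : c * (k%:R - n%:R * x) ^+ 2 = L * (s ^+ 2 / e).
    by rewrite /c /s; field; rewrite !gt_eqF.
  rewrite -mulrDr ler_wpM2l//.
  have [se|/ltW se] := leP `|s| e.
    by rewrite (le_trans se)// lerDl divr_ge0 ?sqr_ge0// ltW.
  rewrite -[leLHS]add0r lerD ?(ltW e0)// ler_pdivlMr//.
  by rewrite -real_normK ?num_real// expr2 ler_wpM2l.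
have E : bernstein n (fun k => L * e + c * (k%:R - n%:R * x) ^+ 2) x
    <= L * e + L / (e * n%:R).
  rewrite bernsteinD bernstein_cst bernsteinZ bernstein_sqr subrr expr0n/= addr0.
  rewrite lerD2l.
  have -> : L / (e * n%:R) = c * n%:R by rewrite /c; field; rewrite !gt_eqF.
  rewrite ler_wpM2l// -mulrA ler_piMr ?ler0n//.
  by rewrite mulr_ile1 ?subr_ge0// gerBl.
have U : bernstein n (fun k => F (k%:R / n%:R)) x <= F x + (L * e + L / (e * n%:R)).
  rewrite (le_trans _ (lerD (lexx (F x)) E))//.
  rewrite -[in leRHS](bernstein_cst n (F x) x) -bernsteinD.
  apply: le_bernstein => // k; rewrite -lerBlDl.
  by apply: le_trans (bnd k); exact: ler_norm.
have V : F x <= bernstein n (fun k => F (k%:R / n%:R)) x + (L * e + L / (e * n%:R)).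
  rewrite (le_trans _ (lerD (lexx _) E))//.
  rewrite -[leLHS](bernstein_cst n (F x) x) -bernsteinD.
  apply: le_bernstein => // k; rewrite -lerBlDl.
  by apply: le_trans (bnd k); rewrite distrC; exact: ler_norm.
by rewrite ler_distl; apply/andP; split; [rewrite lerBlDr|].
Qed.

End bernstein.

Section bounded_on_01.
Variable R : realType.
Implicit Types f g : R -> R.

(** The bound is asked on the unit interval only, where the laws live, so that polynomials
    qualify. *)
Definition bounded01 f :=
  measurable_fun setT f /\ exists C, forall x, 0 <= x <= 1 -> `|f x| <= C.

Lemma bounded01_cst c : bounded01 (cst c).
Proof. by split; [exact: measurable_cst|exists `|c|]. Qed.

Lemma bounded01_id : bounded01 id.
Proof.
by split => //; exists 1 => x /andP[x0 x1]; rewrite ger0_norm.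
Qed.

Lemma bounded01D f g : bounded01 f -> bounded01 g -> bounded01 (fun x => f x + g x).
Proof.
move=> [mf [C fC]] [mg [C' gC]]; split; first exact: measurable_funD.
by exists (C + C') => x x01; rewrite (le_trans (ler_normD _ _))// lerD ?fC ?gC.
Qed.

Lemma bounded01M f g : bounded01 f -> bounded01 g -> bounded01 (fun x => f x * g x).
Proof.
move=> [mf [C fC]] [mg [C' gC]]; split; first exact: measurable_funM.
by exists (C * C') => x x01; rewrite normrM ler_pM ?fC ?gC.
Qed.

Lemma bounded01Z c f : bounded01 f -> bounded01 (fun x => c * f x).
Proof. by move=> bf; apply: bounded01M => //; exact: bounded01_cst. Qed.

Lemma bounded01B f g : bounded01 f -> bounded01 g -> bounded01 (fun x => f x - g x).
Proof.
move=> bf bg; have := bounded01D bf (bounded01Z (-1) bg).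
by under eq_fun do rewrite mulN1r.
Qed.

Lemma bounded01X f n : bounded01 f -> bounded01 (fun x => f x ^+ n).
Proof.
move=> bf; elim: n => [|n ih].
  by under eq_fun do rewrite expr0; exact: bounded01_cst.
by under eq_fun do rewrite exprS; exact: bounded01M.
Qed.

Lemma bounded01_onem : bounded01 (fun x => 1 - x).
Proof. by apply: bounded01B; [exact: bounded01_cst|exact: bounded01_id]. Qed.

Lemma bounded01_bernstein n (f : nat -> R) : bounded01 (bernstein n f).
Proof.
elim: n f => [|n ih] f; first exact: bounded01_cst.
apply: bounded01D; apply: bounded01M => //; first exact: bounded01_onem.
exact: bounded01_id.
Qed.

End bounded_on_01.

Section weighted_law.
Variables (R : realType) (d : measure_display) (T : measurableType d).
Variables (mu : {measure set T -> \bar R}) (D : set T) (Z h : T -> R).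
Implicit Types f g : R -> R.

(** A common format for the two laws to be compared: a random variable under a probability ([h = 1])
    and a density on []0, 1[] ([Z = id]). *)
Record weighted_law : Prop := WeightedLaw {
  wl_domain : measurable D ;
  wl_var : measurable_fun D Z ;
  wl_weight : measurable_fun D h ;
  wl_var01 : forall x, D x -> 0 <= Z x <= 1 ;
  wl_weight_ge0 : forall x, D x -> 0 <= h x ;
  wl_integrable : mu.-integrable D (EFin \o h) }.

Definition wexp f : R := (\int[mu]_(x in D) (f (Z x) * h x))%R.

Hypothesis W : weighted_law.

Lemma wexp_measurable f : measurable_fun setT f ->
  measurable_fun D (fun x => f (Z x) * h x).
Proof.
case: W => mD mZ mh Z01 h0 ih mf; apply: measurable_funM => //.
exact: (measurableT_comp mf mZ).
Qed.

Lemma wexp_integrable f : bounded01 f ->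
  mu.-integrable D (EFin \o (fun x => f (Z x) * h x)).
Proof.
case: (W) => mD mZ mh Z01 h0 ih [mf [C fC]].
have := @integrableZl _ _ _ mu D mD C _ ih; apply: le_integrable => //.
  by apply/measurable_EFinP; exact: wexp_measurable.
move=> x Dx /=; rewrite lee_fin !normrM ler_wpM2r// (le_trans (fC _ (Z01 _ Dx)))//.
exact: ler_norm.
Qed.

Lemma wexpD f g : bounded01 f -> bounded01 g ->
  wexp (fun x => f x + g x) = wexp f + wexp g.
Proof.
case: (W) => mD _ _ _ _ _ bf bg; rewrite /wexp.
rewrite -RintegralD//; [|exact: wexp_integrable..].
by apply: eq_Rintegral => x _; rewrite mulrDl.
Qed.

Lemma wexpZ c f : bounded01 f -> wexp (fun x => c * f x) = c * wexp f.
Proof.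
case: (W) => mD _ _ _ _ _ bf; rewrite /wexp -RintegralZl//; last exact: wexp_integrable.
by apply: eq_Rintegral => x _; rewrite mulrA.
Qed.

Lemma wexpB f g : bounded01 f -> bounded01 g ->
  wexp (fun x => f x - g x) = wexp f - wexp g.
Proof.
move=> bf bg; have := wexpD bf (bounded01Z (-1) bg).
by rewrite wexpZ// mulN1r => <-; congr wexp; apply/funext => x; rewrite mulN1r.
Qed.

Lemma le_wexp f g : bounded01 f -> bounded01 g ->
  (forall x, 0 <= x <= 1 -> f x <= g x) -> wexp f <= wexp g.
Proof.
case: (W) => mD _ _ Z01 h0 _ bf bg fg; apply: le_Rintegral => //.
- exact: wexp_integrable.
- exact: wexp_integrable.
- by move=> x Dx; apply: ler_wpM2r; [exact: h0|exact/fg/Z01].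
Qed.

Lemma eq_wexp f g : (forall x, 0 <= x <= 1 -> f x = g x) -> wexp f = wexp g.
Proof.
case: (W) => mD _ _ Z01 _ _ fg; apply: eq_Rintegral => x; rewrite inE => Dx.
by rewrite fg// Z01.
Qed.

Lemma wexp_norm_le f g c : bounded01 f -> bounded01 g ->
  (forall x, 0 <= x <= 1 -> `|f x - g x| <= c) ->
  `|wexp f - wexp g| <= c * wexp (cst 1).
Proof.
move=> bf bg fg.
have cE : c * wexp (cst 1) = wexp (cst c).
  rewrite -wexpZ; last exact: bounded01_cst.
  by apply: eq_wexp => x _ /=; rewrite mulr1.
rewrite ler_distl cE; apply/andP; split.
  rewrite -wexpB//; last exact: bounded01_cst.
  apply: le_wexp => //; first by apply: bounded01B => //; exact: bounded01_cst.
  by move=> x /fg; rewrite ler_distl /= => /andP[].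
rewrite -wexpD//; last exact: bounded01_cst.
apply: le_wexp => //; first by apply: bounded01D => //; exact: bounded01_cst.
by move=> x /fg; rewrite ler_distl /= => /andP[].
Qed.

Lemma wexp_cvg (F : (R -> R)^nat) f C : (forall n, measurable_fun setT (F n)) ->
    measurable_fun setT f ->
    (forall n x, `|F n x| <= C) -> (forall x, F n x @[n --> \oo] --> f x) ->
  wexp (F n) @[n --> \oo] --> wexp f.
Proof.
case: (W) => mD mZ mh Z01 h0 ih mF mf FC Ff.
have [| | | | |] := @dominated_convergence _ _ _ mu D mD
  (fun n x => (F n (Z x) * h x)%:E) (fun x => (f (Z x) * h x)%:E)
  (fun x => (C%:E * (h x)%:E)%E).
- by move=> n; apply/measurable_EFinP; exact: wexp_measurable.
- by apply/measurable_EFinP; exact: wexp_measurable.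
- apply: aeW => x Dx; apply: cvg_EFin; first exact: nearW.
  by apply: cvgMl; exact: Ff.
- exact: integrableZl.
- apply: aeW => x n Dx; rewrite /= lee_fin normrM (ger0_norm (h0 _ Dx)).
  by apply: ler_wpM2r; [exact: h0|exact: FC].
move=> fi _ cv; apply: fine_cvg; rewrite /wexp /Rintegral fineK//.
exact: integrable_fin_num.
Qed.

End weighted_law.

Section moment_determinacy.
Variables (R : realType).
Variables (d1 : measure_display) (T1 : measurableType d1).
Variables (d2 : measure_display) (T2 : measurableType d2).
Variables (m1 : {measure set T1 -> \bar R}) (D1 : set T1) (Z1 h1 : T1 -> R).
Variables (m2 : {measure set T2 -> \bar R}) (D2 : set T2) (Z2 h2 : T2 -> R).
Hypothesis W1 : weighted_law m1 D1 Z1 h1.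
Hypothesis W2 : weighted_law m2 D2 Z2 h2.
Local Notation E1 := (wexp m1 D1 Z1 h1).
Local Notation E2 := (wexp m2 D2 Z2 h2).
Hypothesis E12 : forall k, E1 (fun x => x ^+ k) = E2 (fun x => x ^+ k).

Let bXX i j : bounded01 (fun x : R => x ^+ i * (1 - x) ^+ j).
Proof.
apply: bounded01M; apply: bounded01X; [exact: bounded01_id|exact: bounded01_onem].
Qed.

Let mixed_moments i j :
  E1 (fun x => x ^+ i * (1 - x) ^+ j) = E2 (fun x => x ^+ i * (1 - x) ^+ j).
Proof.
elim: j i => [|j ih] i; first by under eq_fun do rewrite expr0 mulr1; exact: E12.
have -> : (fun x : R => x ^+ i * (1 - x) ^+ j.+1) =
    (fun x => x ^+ i * (1 - x) ^+ j - x ^+ i.+1 * (1 - x) ^+ j).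
  by apply/funext => x; rewrite !exprS; ring.
by rewrite (wexpB W1)// (wexpB W2)// !ih.
Qed.

(** The recursion of [bernstein] multiplies by [1 - x] or [x]; the factors [x ^+ i] and
    [(1 - x) ^+ j] absorb these in the induction. *)
Let bernstein_moments n (f : nat -> R) i j :
  E1 (fun x => x ^+ i * (1 - x) ^+ j * bernstein n f x) =
  E2 (fun x => x ^+ i * (1 - x) ^+ j * bernstein n f x).
Proof.
elim: n f i j => [|n ih] f i j.
  have -> : (fun x : R => x ^+ i * (1 - x) ^+ j * bernstein 0 f x) =
      (fun x => f 0%N * (x ^+ i * (1 - x) ^+ j)).
    by apply/funext => x; rewrite mulrC.
  by rewrite (wexpZ W1)// (wexpZ W2)// mixed_moments.
have -> : (fun x : R => x ^+ i * (1 - x) ^+ j * bernstein n.+1 f x) =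
    (fun x => x ^+ i * (1 - x) ^+ j.+1 * bernstein n f x +
              x ^+ i.+1 * (1 - x) ^+ j * bernstein n (fun k => f k.+1) x).
  by apply/funext => x /=; rewrite !exprS; ring.
have b k l g : bounded01 (fun x : R => x ^+ k * (1 - x) ^+ l * bernstein n g x).
  by apply: bounded01M; [exact: bXX|exact: bounded01_bernstein].
by rewrite (wexpD W1)// (wexpD W2)// !ih.
Qed.

(** Equal moments give equal integrals of Bernstein polynomials, which approximate a Lipschitz
    function uniformly. *)
Lemma moments_eq_lipschitz (F : R -> R) L : bounded01 F -> 0 <= L ->
  (forall s t, `|F s - F t| <= L * `|s - t|) -> E1 F = E2 F.
Proof.
move=> bF L0 HL.
pose C := E1 (cst 1) + E2 (cst 1).
have C0 : 0 <= C.
  have p (d : measure_display) (T : measurableType d) (m : {measure set T -> \bar R}) D Z h :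
      weighted_law m D Z h -> 0 <= wexp m D Z h (cst 1).
    case=> _ _ _ _ h0 _; apply: Rintegral_ge0 => x Dx.
    by rewrite /= mul1r h0.
  by rewrite addr_ge0// (p _ _ _ _ _ _ W1, p _ _ _ _ _ _ W2).
have key e n : (0 < n)%N -> 0 < e ->
    `|E1 F - E2 F| <= (L * e + L / (e * n%:R)) * C.
  move=> n0 e0.
  pose B := bernstein n (fun k => F (k%:R / n%:R)).
  have bB : bounded01 B by exact: bounded01_bernstein.
  have FB x : 0 <= x <= 1 -> `|F x - B x| <= L * e + L / (e * n%:R).
    by move=> x01; exact: bernstein_lipschitz.
  have EB : E1 B = E2 B.
    have := bernstein_moments n (fun k => F (k%:R / n%:R)) 0 0.
    by under eq_fun do rewrite !expr0 !mul1r.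
  have -> : E1 F - E2 F = (E1 F - E1 B) - (E2 F - E2 B) by rewrite EB; ring.
  rewrite (le_trans (ler_normB _ _))// mulrDr lerD//.
    exact: (wexp_norm_le W1).
  exact: (wexp_norm_le W2).
apply/eqP; rewrite -subr_eq0 -normr_le0; apply/ler_addgt0Pr => e e0.
rewrite add0r.
(* The added ones keep [M] positive. With [n >= eps ^- 2] each error term is at most [L * eps], and
   [2 * eps * M = e]. *)
pose M := (L + 1) * (C + 1).
have M0 : 0 < M by rewrite mulr_gt0// ltr_wpDl.
pose eps := e / (2 * M).
have eps0 : 0 < eps by rewrite divr_gt0// mulr_gt0.
pose n := (Num.bound (eps ^- 2)).+1.
have nb : eps ^- 2 <= n%:R.
  rewrite (@le_trans _ _ (Num.bound (eps ^- 2))%:R)//.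
    by rewrite ltW// archi_boundP// invr_ge0 exprn_ge0// ltW.
  by rewrite ler_nat.
apply: le_trans (key eps n _ eps0) _ => //.
have hL : L / (eps * n%:R) <= L * eps.
  rewrite ler_wpM2l// invfM.
  rewrite (@le_trans _ _ (eps^-1 * eps ^+ 2))//.
    rewrite ler_wpM2l ?invr_ge0 ?(ltW eps0)//.
    by rewrite -[leRHS]invrK lef_pV2 ?posrE ?invr_gt0 ?exprn_gt0// ltr0n.
  by rewrite expr2 mulrA mulVf ?mul1r// gt_eqF.
apply: (@le_trans _ _ (2 * eps * (L * C))).
  have -> : 2 * eps * (L * C) = (L * eps + L * eps) * C by ring.
  by rewrite ler_wpM2r// lerD2l.
apply: (@le_trans _ _ (2 * eps * M)).
  apply: ler_wpM2l; first by rewrite mulr_ge0// ltW.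
  by apply: ler_pM; rewrite ?lerDl.
by rewrite /eps le_eqVlt; apply/orP; left; apply/eqP; field; rewrite gt_eqF.
Qed.

(** The indicator is the pointwise limit of ramps rising from 0 at [y] to 1 at [y + 1 / n], the
    [n]-th of which is [n]-Lipschitz. *)
Lemma moments_eq_tail y : E1 (fun x => (y < x)%R%:R) = E2 (fun x => (y < x)%R%:R).
Proof.
pose F (n : nat) (x : R) := Num.min 1 (Num.max 0 (n%:R * (x - y))).
have mF n : measurable_fun setT (F n).
  apply: measurable_minr; first exact: measurable_cst.
  apply: measurable_maxr; first exact: measurable_cst.
  by apply: measurable_funM => //; exact: measurable_funB.
have F01 n x : 0 <= F n x <= 1.
  by rewrite /F le_min ge_min lexx /= ler01 /= le_max lexx.
have FC n x : `|F n x| <= 1 by have /andP[a b] := F01 n x; rewrite ger0_norm.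
have mi : measurable_fun setT (fun x : R => (y < x)%R%:R : R).
  have -> : (fun x : R => (y < x)%R%:R : R) = \1_(`]y, +oo[%classic : set R).
    apply/funext => x; rewrite indicE; congr (nat_of_bool _)%:R.
    by rewrite mem_setE in_itv/= andbT.
  exact: measurable_indic.
have Fcvg x : F n x @[n --> \oo] --> ((y < x)%R%:R : R).
  have [yx|xy] := ltP y x; last first.
    rewrite (_ : (fun n => F n x) = cst 0); first exact: cvg_cst.
    apply/funext => n; rewrite /F /=; rewrite max_l ?min_r//.
    by rewrite mulr_ge0_le0// subr_le0.
  apply: cvg_near_cst; near=> n.
  rewrite /F /= min_l// le_max; apply/orP; right.
  rewrite -ler_pdivrMr ?subr_gt0// div1r.
  near: n; exact: nbhs_infty_ger.
have lip n s t : `|F n s - F n t| <= n%:R * `|s - t|.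
  have E1' : n%:R * `|s - t| = `|n%:R * (s - y) - n%:R * (t - y)|.
    by rewrite -mulrBr normrM normr_nat; congr (_ * `|_|); ring.
  rewrite E1' /F; move: (n%:R * (s - y)) (n%:R * (t - y)) => u v.
  rewrite /Num.min /Num.max; do ! case: ifPn; rewrite ?ltNge ?negbK => *;
  rewrite ler_norml; apply/andP; split; case: (ler0P (u - v)); lra.
have FE n : E1 (F n) = E2 (F n).
  apply: (@moments_eq_lipschitz _ n%:R) => //; split => //.
  by exists 1.
have c1 := wexp_cvg W1 mF mi FC Fcvg.
have c2 := wexp_cvg W2 mF mi FC Fcvg.
apply: cvg_unique c1 _; first exact: Rhausdorff.
by rewrite /=; under eq_fun do rewrite FE.
Unshelve. all: by end_near. Qed.

End moment_determinacy.

(** * From tails to laws on Borel sets *)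

Section density_measure.
Variables (d : measure_display) (T : measurableType d) (R : realType).
Variables (mu : {measure set T -> \bar R}) (f : T -> R).
Hypotheses (f0 : forall x, 0 <= f x) (mf : measurable_fun setT f).

(** The two facts about [f] are arguments so that the measure structure can be attached to the term
    itself. *)
Definition density_measure of (forall x, 0 <= f x) & measurable_fun setT f
    : set T -> \bar R :=
  fun A => (\int[mu]_(x in A) (f x)%:E)%E.

Local Notation nu := (density_measure f0 mf).

Let nu0 : nu set0 = 0%E.
Proof. by rewrite /density_measure integral_set0. Qed.

Let nu_ge0 A : (0 <= nu A)%E.
Proof. by apply: integral_ge0 => x _; rewrite lee_fin. Qed.

Let nu_sigma_additive : semi_sigma_additive nu.
Proof.
move=> /= F mF tF mUF; rewrite /density_measure; apply: cvg_toP.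
  apply: ereal_nondecreasing_is_cvgn => m n mn.
  by apply: lee_sum_nneg_natr => // k _ _; exact: nu_ge0.
rewrite ge0_integral_bigcup//=.
- by apply/measurable_EFinP/measurable_funTS.
- by move=> x _; rewrite lee_fin.
Qed.

HB.instance Definition _ := isMeasure.Build _ _ _ nu nu0 nu_ge0 nu_sigma_additive.

End density_measure.

Section law_of_moments.
Variables (R : realType) (d : measure_display) (T : measurableType d).
Variables (P : probability T R) (Z : {RV P >-> R}) (h : R -> R).
Hypotheses (Z01 : forall omega, 0 <= Z omega <= 1).
Hypotheses (h0 : forall x, 0 <= h x) (mh : measurable_fun setT h).
Local Notation mu := (@lebesgue_measure R).
Hypothesis moments : forall k, exists2 m : R,
  (\int[P]_omega (Z omega ^+ k)%:E = m%:E)%E &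
  (\int[mu]_(x in `]0%R, 1%R[) (x ^+ k * h x)%:E = m%:E)%E.

(** Extension by zero turns the density on []0, 1[] into a measure on the whole line. *)
Let hD : R -> R := h \_ ([set` `]0%R, 1%R[] : set R).

Let hD0 x : 0 <= hD x.
Proof. by rewrite /hD patchE; case: ifP. Qed.

Let mhD : measurable_fun setT hD.
Proof. by apply/(measurable_restrictT h) => //; exact: measurable_funTS. Qed.

Let WZ : weighted_law P setT Z (cst 1).
Proof.
split => //.
exact: finite_measure_integrable_cst.
Qed.

Let Wh : weighted_law mu [set` `]0%R, 1%R[] id h.
Proof.
split => //.
- exact: measurable_funTS.
- by move=> x /=; rewrite in_itv/= => /andP[/ltW -> /ltW ->].
- have [m _ mE] := moments 0.
  apply/integrableP; split.
    by apply/measurable_EFinP; exact: measurable_funTS.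
  under eq_integral do rewrite /= ger0_norm//.
  rewrite (_ : (\int[mu]_(x in _) _)%E = m%:E) ?ltry// -mE.
  by apply: eq_integral => x _; rewrite expr0 mul1r.
Qed.

Let tail y : P (Z @^-1` [set` `]y, +oo[]) = (\int[mu]_(x in `]y, +oo[) (hD x)%:E)%E.
Proof.
have mom k : wexp P setT Z (cst 1) (fun x => x ^+ k) =
    wexp mu [set` `]0%R, 1%R[] id h (fun x => x ^+ k).
  have [m e1 e2] := moments k; rewrite /wexp /Rintegral e2 -e1.
  by under eq_integral do rewrite mulr1.
have := congr1 (@EFin R) (moments_eq_tail WZ Wh mom y).
have b : bounded01 (fun x : R => (y < x)%R%:R : R).
  split; last by exists 1 => x _; case: (_ < _) => /=; rewrite ?normr1 ?normr0.
  have -> : (fun x : R => (y < x)%R%:R : R) = \1_([set` `]y, +oo[] : set R).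
    apply/funext => x; rewrite indicE; congr (nat_of_bool _)%:R.
    by rewrite mem_setE in_itv/= andbT.
  exact: measurable_indic.
have i1 := wexp_integrable WZ b; have i2 := wexp_integrable Wh b.
rewrite /wexp /Rintegral.
rewrite !fineK; [|exact: integrable_fin_num..].
have mA : measurable (Z @^-1` [set` `]y, +oo[]).
  by apply: measurable_funPTI; exact: measurable_itv.
have -> : (\int[P]_omega ((y < Z omega)%R%:R * cst 1 omega)%:E =
    P (Z @^-1` [set` `]y, +oo[]))%E.
  rewrite -[in RHS](setIT (Z @^-1` _)) -integral_indic//; apply: eq_integral => omega _.
  rewrite mulr1 indicE; congr (nat_of_bool _)%:R%:E.
  by apply/idP/idP; rewrite inE/= in_itv/= andbT.
move=> ->; rewrite integral_mkcond [RHS]integral_mkcond; apply: eq_integral => x _.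
rewrite !patchE /hD patchE.
have -> : (x \in [set` `]y, +oo[]) = (y < x) by rewrite mem_setE in_itv/= andbT.
by case: ifPn => _; case: ifPn => _ //=; rewrite ?mul0r ?mul1r.
Qed.

(** The open right rays are stable under intersection and generate the Borel sets, and both measures
    agree on them by [tail]; the rays from [- n] exhaust the line and have finite mass. *)
Lemma law_of_moments (A : set R) : measurable A ->
  distribution P Z A = (\int[mu]_(x in A `&` `]0%R, 1%R[) (h x)%:E)%E.
Proof.
move=> mA; rewrite integral_mkcondr.
under eq_integral do rewrite restrict_EFin.
rewrite -[RHS]/(density_measure mu hD0 mhD A).
(* [Z] is retyped so that its law and the Lebesgue measure live on the same measurable type. *)
have mZ : measurable_fun setT (Z : T -> measurableTypeR R).
  by move=> _ B mB; rewrite setTI; exact: (measurable_funPTI Z mB).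
pose Z' : {mfun T >-> measurableTypeR R} :=
  HB.pack (Z : T -> measurableTypeR R) (isMeasurableFun.Build _ _ _ _ _ mZ).
rewrite -[LHS]/(distribution P Z' A).
apply: (@measure_unique _ R (measurableTypeR R) (@RGenOInfty.G R)
   (fun n : nat => [set` `](- n%:R : R), +oo[])) => //.
- exact: RGenOInfty.measurableE.
- move=> _ _ [x ->] [y ->]; exists (Num.max x y).
  apply/seteqP; split => z/=; rewrite !in_itv/= !andbT gt_max.
    by move=> [-> ->].
  by move=> /andP[].
- by move=> n; exists (- n%:R).
- apply/seteqP; split => // x _; exists (Num.bound `|x|) => //=.
  rewrite in_itv/= andbT ltrNl (le_lt_trans (ler_norm _))// normrN.
  exact: archi_boundP.
- by move=> _ [y ->]; exact: tail.
- move=> n; apply: le_lt_trans (probability_le1 _ _) (ltry _).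
  exact: measurable_itv.
Qed.

End law_of_moments.

Section beta_mixture.
Variable R : realType.
Local Notation mu := (@lebesgue_measure R).

Lemma Gamma_ge0 (a : R) : 0 <= Gamma a.
Proof. by apply: Rintegral_ge0 => x _; exact: gamma_integrand_ge0. Qed.

Lemma beta_density_ge0 (a b x : R) : 0 <= beta_density a b x.
Proof. by rewrite /beta_density !mulr_ge0 ?invr_ge0 ?mulr_ge0 ?Gamma_ge0 ?powR_ge0. Qed.

Lemma measurable_beta_density (a b : R) : measurable_fun setT (beta_density a b).
Proof.
apply: measurable_funM.
  by apply: measurable_funM => //; exact: measurable_powR.
apply: (@measurableT_comp _ _ _ _ _ _ (fun x : R => x `^ (b - 1))).
  exact: measurable_powR.
exact: measurable_funB.
Qed.

Definition beta_mixture (p q a b a' b' x : R) : R :=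
  p * beta_density a b x + q * beta_density a' b' x.

Lemma integral_beta_mixture (p q a b a' b' : R) (g : R -> R) (D : set R) :
    measurable D -> measurable_fun setT g -> (forall x, D x -> 0 <= g x) ->
    0 <= p -> 0 <= q ->
  (\int[mu]_(x in D) (g x * beta_mixture p q a b a' b' x)%:E =
   p%:E * \int[mu]_(x in D) (g x * beta_density a b x)%:E +
   q%:E * \int[mu]_(x in D) (g x * beta_density a' b' x)%:E)%E.
Proof.
move=> mD mg g0 p0 q0.
have md c e : measurable_fun D (fun x => (g x * beta_density c e x)%:E).
  apply/measurable_EFinP/measurable_funTS; apply: measurable_funM => //.
  exact: measurable_beta_density.
have d0 c e x : D x -> (0 <= (g x * beta_density c e x)%:E)%E.
  by move=> Dx; rewrite lee_fin mulr_ge0 ?g0// beta_density_ge0.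
transitivity (\int[mu]_(x in D) (p%:E * (g x * beta_density a b x)%:E +
    q%:E * (g x * beta_density a' b' x)%:E))%E.
  apply: eq_integral => x _; rewrite -!EFinM -EFinD; congr EFin.
  by rewrite /beta_mixture mulrDr !(mulrCA (g x)).
rewrite ge0_integralD//=; last 4 first.
- by move=> x Dx; rewrite mule_ge0 ?lee_fin// -lee_fin d0.
- by apply: measurable_funeM; exact: md.
- by move=> x Dx; rewrite mule_ge0 ?lee_fin// -lee_fin d0.
- by apply: measurable_funeM; exact: md.
by congr (_ + _)%E; rewrite ge0_integralZl//; (exact: md || exact: d0).
Qed.

End beta_mixture.

(** * Histories and descendants *)

Section histories.
Variable r : nat.
Implicit Types (g : multigraph) (t x y : nat).

(** For [m = 1] each vertex brings exactly one edge, so the [i]-th entry of a history is [(i, y)]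
    with [1 <= y <= i]. *)
Definition valid_history t g :=
  (unzip1 g == iota 1 t) && all (fun e => (1 <= e.2 <= e.1)%N) g.

Fixpoint histories t : seq multigraph :=
  if t is t'.+1 then
    [seq rcons g (t'.+1, y) | g <- histories t', y <- iota 1 t'.+1]
  else [:: [::]].

Lemma iota1S t : iota 1 t.+1 = iota 1 t ++ [:: t.+1].
Proof. by have := iotaD 1 t 1; rewrite addn1 add1n. Qed.

Lemma historiesS t :
  histories t.+1 = [seq rcons g (t.+1, y) | g <- histories t, y <- iota 1 t.+1].
Proof. by []. Qed.

Lemma valid_history_rcons t g y : valid_history t g -> (1 <= y <= t.+1)%N ->
  valid_history t.+1 (rcons g (t.+1, y)).
Proof.
move=> /andP[/eqP gE ga] yt; apply/andP; split; last by rewrite all_rcons/= yt.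
by rewrite iota1S /unzip1 map_rcons -/(unzip1 g) gE cats1.
Qed.

Lemma histories_valid t g : g \in histories t -> valid_history t g.
Proof.
elim: t g => [|t ih] g; first by rewrite inE => /eqP ->.
rewrite historiesS => /allpairsP[[g' y] [/ih vg']]; rewrite mem_iota => yt ->.
by apply: valid_history_rcons => //; rewrite add1n ltnS in yt.
Qed.

Lemma uniq_histories t : uniq (histories t).
Proof.
elim: t => [//|t ih]; rewrite historiesS; apply: allpairs_uniq => //; first exact: iota_uniq.
by move=> [g y] [g' y'] _ _ /= /rcons_inj[-> ->].
Qed.

Lemma degree_rcons g v y x :
  degree (rcons g (v, y)) x = (degree g x + ((v == x) + (y == x)))%N.
Proof. by rewrite /degree -cats1 big_cat big_seq1. Qed.

Lemma valid_history_mem t g v y : valid_history t g -> (v, y) \in g ->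
  (v <= t)%N /\ (1 <= y <= v)%N.
Proof.
move=> /andP[/eqP gE /allP ga] vy; split; last by have /= := ga _ vy.
have : v \in unzip1 g by apply/mapP; exists (v, y).
by rewrite gE mem_iota add1n ltnS => /andP[].
Qed.

Lemma degree_gt t g x : valid_history t g -> (t < x)%N -> degree g x = 0%N.
Proof.
move=> vg tx; rewrite /degree big_seq big1// => -[v y] vy.
have [vt /andP[_ yv]] := valid_history_mem vg vy.
rewrite /= !ltn_eqF//; first exact: leq_ltn_trans (leq_trans yv vt) tx.
exact: leq_ltn_trans vt tx.
Qed.

Lemma descendant_ge g x : descendant g r x -> (r <= x)%N.
Proof. by elim=> [//|{}x y rx _ _ _ _]; exact: ltnW. Qed.

Lemma descendant_inv g x : descendant g r x ->
  x = r \/ exists z, [/\ (x, z) \in g, (z < x)%N & descendant g r z].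
Proof. by case=> [|{}x z _ xz zx dz]; [left|right; exists z]. Qed.

(** Labels decrease along a path to [r], so a path from [x <= t] never uses the edge of [t + 1]. *)
Lemma descendant_rcons t g y x : (x <= t)%N ->
  descendant (rcons g (t.+1, y)) r x <-> descendant g r x.
Proof.
move=> xt; split => [dx|].
  elim: dx xt => [|{}x z rx]; first by move=> _; exact: descendant_root.
  rewrite mem_rcons inE => /predU1P[[-> _]|xz zx _ ih xt]; first by rewrite ltnn.
  by apply: (@descendant_step _ _ _ z) => //; apply: ih; exact: leq_trans (ltnW zx) xt.
move=> dx; clear xt; elim: dx => [|{}x z rx xz zx _ ih]; first exact: descendant_root.
by apply: (@descendant_step _ _ _ z) => //; rewrite mem_rcons inE xz orbT.
Qed.

(** The new edge is the only one brought by [t + 1]; if it is a loop it leads nowhere. *)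
Lemma descendant_new t g y : valid_history t g -> (r <= t)%N ->
  descendant (rcons g (t.+1, y)) r t.+1 <-> (y <= t)%N /\ descendant g r y.
Proof.
move=> vg rt; split.
  move=> /descendant_inv[rE|[z [xz zx dz]]]; first by rewrite -rE ltnn in rt.
  move: xz; rewrite mem_rcons inE => /predU1P[[zy]|xz].
    by rewrite zy in dz zx; split => //; exact: (@descendant_rcons t g y y zx).1 dz.
  by have [] := valid_history_mem vg xz; rewrite ltnn.
move=> [yt dy]; apply: (@descendant_step _ _ _ y) => //.
  by rewrite mem_rcons inE eqxx.
exact/descendant_rcons.
Qed.

Definition is_desc g x : bool := `[< descendant g r x >].

Lemma is_desc_rcons t g y x : (x <= t)%N ->
  is_desc (rcons g (t.+1, y)) x = is_desc g x.
Proof. by move=> xt; apply/asboolP/asboolP => /(descendant_rcons g y xt). Qed.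

Lemma is_desc_new t g y : valid_history t g -> (r <= t)%N ->
  is_desc (rcons g (t.+1, y)) t.+1 = (y <= t)%N && is_desc g y.
Proof.
move=> vg rt; apply/asboolP/andP => [/(descendant_new _ vg rt)[? ?]|[? /asboolP ?]].
  by split => //; exact/asboolP.
exact/(descendant_new _ vg rt).
Qed.

Lemma num_descendants_rcons t g y : valid_history t g -> (r <= t)%N ->
  num_descendants (rcons g (t.+1, y)) r t.+1 =
  (num_descendants g r t + ((y <= t)%N && is_desc g y))%N.
Proof.
move=> vg rt; rewrite /num_descendants iota1S count_cat /= addn0.
rewrite -!/(is_desc _ _) is_desc_new//; congr addn.
apply: eq_in_count => x; rewrite mem_iota add1n ltnS => /andP[_ xt].
exact: is_desc_rcons.
Qed.

Lemma num_descendants_root g : (0 < r)%N -> num_descendants g r r = 1%N.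
Proof.
case: r (@descendant_ge) => // r' dge _; rewrite /num_descendants iota1S.
rewrite count_cat/= addn0.
have -> : `[< descendant g r'.+1 r'.+1 >] by apply/asboolP; exact: descendant_root.
rewrite (eq_in_count (a2 := pred0)) ?count_pred0// => x.
rewrite mem_iota add1n ltnS => /andP[_ xr]; apply/asboolP => /dge.
by rewrite leqNgt ltnS xr.
Qed.

Lemma num_descendants_gt0 g t : (0 < r <= t)%N -> (0 < num_descendants g r t)%N.
Proof.
move=> rt; rewrite /num_descendants -has_count; apply/hasP; exists r.
  by rewrite mem_iota add1n ltnS.
by apply/asboolP; exact: descendant_root.
Qed.

Lemma num_descendants_le g t : (num_descendants g r t <= t)%N.
Proof. by rewrite /num_descendants -[leqRHS](size_iota 1) count_size. Qed.

Lemma sum_degree t g : valid_history t g ->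
  (\sum_(x <- iota 1 t) degree g x = 2 * t)%N.
Proof.
move=> vg; rewrite /degree exchange_big /=.
rewrite big_seq (eq_bigr (fun=> 2%N)).
  rewrite -big_seq big_const_seq count_predT iter_addn_0; congr muln.
  by have /andP[/eqP /(congr1 size)] := vg; rewrite size_map size_iota.
move=> [v y] vy; have [vt /andP[y1 yv]] := valid_history_mem vg vy.
have one z : (1 <= z <= t)%N -> (\sum_(x <- iota 1 t) (z == x) = 1)%N.
  move=> zt; rewrite (eq_bigr (fun x => if pred1 z x then 1 else 0)%N); last first.
    by move=> x _; rewrite /= eq_sym; case: eqP.
  rewrite -big_mkcond/= sum1_count count_uniq_mem ?iota_uniq//.
  by rewrite mem_iota add1n ltnS zt.
rewrite big_split/= !one ?y1 ?(leq_trans yv vt)//.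
by rewrite vt (leq_trans y1 yv).
Qed.

Lemma valid_historyS t g : valid_history t.+1 g ->
  exists g' y, [/\ g = rcons g' (t.+1, y), valid_history t g',
                   (1 <= y)%N & (y <= t.+1)%N].
Proof.
case/lastP: g => [|g [v y]] vg.
  by have /andP[/eqP/(congr1 size)] := vg; rewrite size_iota.
have := vg; rewrite /valid_history /unzip1 map_rcons all_rcons iota1S cats1.
move=> /andP[/eqP/rcons_inj[gE vE]] /andP[/= /andP[y1 yt] ga]; subst v.
by exists g, y; split => //; rewrite /valid_history /unzip1 gE eqxx.
Qed.

(** By induction on [t]: a new descendant adds 2 to the degree sum, any other vertex adds nothing,
    and at time [r] only the edge of [r] counts. The successor on the left avoids a truncated
    subtraction. *)
Lemma sum_degree_descendants t g : (0 < r <= t)%N -> valid_history t g ->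
  ((\sum_(x <- iota 1 t | is_desc g x) degree g x).+1 =
   2 * num_descendants g r t + ((r, r) \in g))%N.
Proof.
move=> /andP[r0]; elim: t g => [|t ih] g; first by rewrite leqNgt r0.
move=> rt vg; have [g' [y [gE vg' y1 yt]]] := valid_historyS vg.
rewrite {}gE {g} in vg *.
rewrite iota1S big_cat big_cons big_nil /= addn0.
rewrite degree_rcons (degree_gt vg')// eqxx add0n.
rewrite big_seq_cond (eq_bigl (fun x => (x \in iota 1 t) && is_desc g' x)); last first.
  move=> x; rewrite mem_iota add1n ltnS; case: (boolP (0 < x <= t)%N) => //= /andP[_ xt].
  exact: is_desc_rcons.
rewrite (eq_bigr (fun x => degree g' x + (y == x))%N); last first.
  move=> x /andP[]; rewrite mem_iota add1n ltnS => /andP[_ xt] _.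
  by rewrite degree_rcons eq_sym [x == _]ltn_eqF// ltnS.
rewrite -big_seq_cond.
have rrE : ((r, r) \in rcons g' (t.+1, y)) = ((r == t.+1) && (y == r)) || ((r, r) \in g').
  by rewrite mem_rcons inE xpair_eqE; case: eqP => //= ->; rewrite eq_sym.
move: rt; rewrite rrE leq_eqVlt => /predU1P[rE|rt].
  rewrite {1}rE -rE num_descendants_root// eqxx/=.
  rewrite big_seq_cond big_pred0; last first.
    move=> x; rewrite mem_iota add1n; apply/negP.
    move=> /andP[/andP[_ xr]] /asboolP /descendant_ge.
    by rewrite leqNgt rE xr.
  have -> : is_desc (rcons g' (r, y)) r by apply/asboolP; exact: descendant_root.
  have -> : ((r, r) \in g') = false.
    by apply/negP => /(valid_history_mem vg')[]; rewrite rE ltnn.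
  by rewrite orbF; case: eqP.
rewrite ltnS in rt.
rewrite (ltn_eqF (_ : r < t.+1)%N)//= num_descendants_rcons// is_desc_new//.
rewrite big_split/=.
have -> : (\sum_(x <- iota 1 t | is_desc g' x) (y == x) = ((y <= t) && is_desc g' y))%N.
  rewrite (eq_bigr (fun x => if pred1 y x then 1 else 0)%N); last first.
    by move=> x _; rewrite /= eq_sym; case: eqP.
  rewrite -big_mkcondr/= sum1_count.
  rewrite (eq_count (a2 := fun x => is_desc g' y && pred1 y x)); last first.
    by move=> x /=; case: (x =P y) => [->|]; rewrite ?andbF.
  case: (is_desc g' y) => /=; last by rewrite andbF (eq_count (a2 := pred0)) ?count_pred0.
  by rewrite count_uniq_mem ?iota_uniq// mem_iota add1n ltnS y1 andbT.
have := ih g' rt vg'; case: ifPn => [/andP[yt' dy]|_].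
  rewrite (ltn_eqF (_ : y < t.+1)%N)//= => ihE.
  by move: ihE; lia.
by rewrite !addn0.
Qed.

End histories.

(** * The Polya urn of descendants *)

Section attachment_expectation.
Variables (R : realType) (delta : R).
Hypothesis hdelta : -1 < delta.
Implicit Types (g : multigraph) (t : nat) (phi psi : multigraph -> R).

(** At [t = 0] the formula gives probability 1 to the loop of vertex 1, so the initial graph is
    treated like the other steps. *)
Definition attach_prob t g (y : nat) : R :=
  ((if (y <= t)%N then (degree g y)%:R + delta else 1 + delta)
   / pa_norm 1 delta t 1).

(** The tower property taken as a definition: the inner sum is the conditional expectation given the
    history at time [t']. *)
Fixpoint pa_expect t phi : R :=
  if t is t'.+1 then
    pa_expect t' (fun g => \sum_(y <- iota 1 t)
      attach_prob t' g y * phi (rcons g (t, y)))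
  else phi [::].

Lemma pa_expectS t phi : pa_expect t.+1 phi =
  pa_expect t (fun g => \sum_(y <- iota 1 t.+1)
    attach_prob t g y * phi (rcons g (t.+1, y))).
Proof. by []. Qed.

Lemma pa_normE t : pa_norm 1 delta t 1 = (2 + delta) * t%:R + (1 + delta).
Proof. by rewrite /pa_norm !mulr1 mul1r divr1; ring. Qed.

Lemma pa_norm_gt0 t : 0 < pa_norm 1 delta t 1.
Proof.
rewrite pa_normE ltr_wpDl//; last by rewrite -ltrBlDl sub0r.
by rewrite mulr_ge0// -lerBlDl sub0r ltW// (lt_trans _ hdelta)// ltrN2 ltr1n.
Qed.

Lemma eq_pa_expect t phi psi : (forall g, valid_history t g -> phi g = psi g) ->
  pa_expect t phi = pa_expect t psi.
Proof.
elim: t phi psi => [|t ih] phi psi e; first exact: e.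
rewrite !pa_expectS; apply: ih => g vg; rewrite big_seq [RHS]big_seq; apply: eq_bigr => y.
rewrite mem_iota add1n ltnS => yt; congr (_ * _); apply: e.
exact: valid_history_rcons.
Qed.

Lemma pa_expectD t phi psi :
  pa_expect t (fun g => phi g + psi g) = pa_expect t phi + pa_expect t psi.
Proof.
elim: t phi psi => [//|t ih] phi psi; rewrite !pa_expectS -ih; apply: eq_pa_expect => g _.
by rewrite -big_split; apply: eq_bigr => y _; rewrite mulrDr.
Qed.

Lemma pa_expectZ t c phi : pa_expect t (fun g => c * phi g) = c * pa_expect t phi.
Proof.
elim: t phi => [//|t ih] phi; rewrite !pa_expectS -ih; apply: eq_pa_expect => g _.
by rewrite mulr_sumr; apply: eq_bigr => y _; rewrite mulrCA.
Qed.

Lemma sum_attach_prob t g : valid_history t g ->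
  \sum_(y <- iota 1 t.+1) attach_prob t g y = 1.
Proof.
move=> vg; rewrite iota1S big_cat big_seq1 /= {2}/attach_prob ltnn.
rewrite big_seq (eq_bigr (fun y => ((degree g y)%:R + delta) / pa_norm 1 delta t 1)).
  rewrite -big_seq -mulr_suml big_split /= -natr_sum (sum_degree vg).
  rewrite big_const_seq count_predT size_iota iter_addr_0 -mulrDl pa_normE.
  rewrite -[delta *+ t]mulr_natr natrM -mulrDl divff// -pa_normE gt_eqF//.
  exact: pa_norm_gt0.
by move=> y; rewrite mem_iota add1n ltnS /attach_prob => /andP[_ ->].
Qed.

Lemma pa_expect_cst t c : pa_expect t (fun=> c) = c.
Proof.
elim: t => [//|t ih]; rewrite pa_expectS -[RHS]ih; apply: eq_pa_expect => g vg.
by rewrite -mulr_suml sum_attach_prob// mul1r.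
Qed.

(** Every present vertex has degree at least 1 through its own edge, and [1 + delta > 0]. *)
Lemma attach_prob_ge0 t g y : valid_history t g -> (1 <= y <= t.+1)%N ->
  0 <= attach_prob t g y.
Proof.
move=> vg /andP[y1 yt]; apply: divr_ge0; last exact/ltW/pa_norm_gt0.
have d1 : 0 <= 1 + delta by rewrite -lerBlDl sub0r ltW.
case: ifPn => // yt'; apply: le_trans d1 _; rewrite lerD2r ler1n.
have /andP[/eqP gE _] := vg.
have : y \in unzip1 g by rewrite gE mem_iota y1 add1n ltnS.
move=> /mapP[[v z] vz /= ->]; rewrite /degree (big_rem _ vz)/= eqxx.
by rewrite add1n addSn.
Qed.

Lemma le_pa_expect t phi psi : (forall g, valid_history t g -> phi g <= psi g) ->
  pa_expect t phi <= pa_expect t psi.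
Proof.
elim: t phi psi => [|t ih] phi psi e; first exact: e.
rewrite !pa_expectS; apply: ih => g vg; rewrite big_seq [leRHS]big_seq; apply: ler_sum => y.
rewrite mem_iota add1n ltnS => yt; apply: ler_wpM2l; first exact: attach_prob_ge0.
by apply: e; exact: valid_history_rcons.
Qed.

Variables (r : nat) (r0 : (0 < r)%N).

Let theta : R := (2 + delta)^-1.

Definition loops_at_root g : bool := (r, r) \in g.

(* [urn_mass t g / urn_total t] is the conditional probability that vertex    *)
(* [t + 1] is a descendant of [r]: these are the parameters of a Polya urn.   *)
Definition urn_mass t g : R :=
  (num_descendants g r t)%:R - (~~ loops_at_root g)%:R * theta.

Definition urn_total t : R := t%:R + 1 - theta.

Let d2 : 0 < 2 + delta.
Proof. by move: hdelta; lra. Qed.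

Let theta0 : 0 < theta.
Proof. by rewrite invr_gt0. Qed.

Let theta1 : theta < 1.
Proof. by rewrite invf_lt1//; move: hdelta; lra. Qed.

Lemma urn_total_gt0 t : 0 < urn_total t.
Proof. by rewrite /urn_total -addrA ltr_wpDl// subr_gt0. Qed.

Lemma urn_totalS t : urn_total t.+1 = urn_total t + 1.
Proof. by rewrite /urn_total -natr1; ring. Qed.

(** With [X] descendants the numerators add up to [(2 + delta) * X], minus 1 when [r] has no loop,
    and the denominator is [(2 + delta) * (t + 1 - theta)]; dividing by [2 + delta] gives mass over
    total. *)
Lemma sum_attach_prob_descendants t g : valid_history t g -> (r <= t)%N ->
  \sum_(y <- iota 1 t.+1) attach_prob t g y * ((y <= t)%N && is_desc r g y)%:R
    = urn_mass t g / urn_total t.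
Proof.
move=> vg rt; rewrite iota1S big_cat big_seq1 /= ltnn mulr0 addr0.
rewrite big_seq (eq_bigr (fun y => (if is_desc r g y then
    ((degree g y)%:R + delta) else 0) / pa_norm 1 delta t 1)); last first.
  move=> y; rewrite mem_iota add1n ltnS /attach_prob => /andP[_ ->] /=.
  by case: ifP; rewrite ?mulr1// mulr0 mul0r.
rewrite -big_seq -mulr_suml -big_mkcond/= big_split/= -natr_sum.
have := sum_degree_descendants (_ : 0 < r <= t)%N vg; rewrite r0 rt => /(_ isT).
set S := bigop _ _ _ => /(congr1 (fun n => n%:R : R)); rewrite -natr1 natrD natrM => SE.
have {SE}-> : S%:R = 2 * (num_descendants g r t)%:R + ((r, r) \in g)%:R - 1 :> R.
  by rewrite -SE addrK.
rewrite big_const_seq iter_addr_0 -[X in count X]/(is_desc r g).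
rewrite -/(num_descendants g r t) -[delta *+ _]mulr_natr /urn_mass /urn_total /loops_at_root.
rewrite pa_normE /theta; have := urn_total_gt0 t; rewrite /urn_total /theta => u0.
have n0 := pa_norm_gt0 t; rewrite pa_normE in n0.
apply/eqP; rewrite eqr_div ?(lt0r_neq0 n0) ?(lt0r_neq0 u0)//; apply/eqP.
by case: ((r, r) \in g) => /=; field; rewrite gt_eqF.
Qed.

Lemma urn_mass_rcons t g y : valid_history t g -> (r <= t)%N ->
  urn_mass t.+1 (rcons g (t.+1, y)) =
  urn_mass t g + ((y <= t)%N && is_desc r g y)%:R.
Proof.
move=> vg rt; rewrite /urn_mass num_descendants_rcons// natrD.
have -> : loops_at_root (rcons g (t.+1, y)) = loops_at_root g.
  rewrite /loops_at_root mem_rcons inE xpair_eqE ltn_eqF//.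
by rewrite addrAC.
Qed.

(** One step of the urn, for functions of the past and of the new mass; all martingale computations
    go through it. *)
Lemma pa_expect_urnS t (F : multigraph -> R -> R) : (r <= t)%N ->
  pa_expect t.+1 (fun g => F (take t g) (urn_mass t.+1 g)) =
  pa_expect t (fun g => F g (urn_mass t g) +
    (F g (urn_mass t g + 1) - F g (urn_mass t g)) * (urn_mass t g / urn_total t)).
Proof.
move=> rt; rewrite pa_expectS; apply: eq_pa_expect => g vg.
rewrite -sum_attach_prob_descendants// mulr_sumr.
rewrite -[X in X + _]mulr1 -[X in _ * X + _](sum_attach_prob vg) mulr_sumr -big_split/=.
apply: eq_bigr => y _; rewrite urn_mass_rcons//.
have -> : take t (rcons g (t.+1, y)) = g.
  have /andP[/eqP/(congr1 size) + _] := vg.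
  by rewrite size_map size_iota -cats1 => <-; rewrite take_size_cat.
by case: (_ && _); rewrite ?addr0 /=; ring.
Qed.

Definition urn_frac t g : R := urn_mass t g / urn_total t.

(* The increments of the martingale [urn_frac] are orthogonal. *)
Lemma urn_frac_increment s u : (r <= s <= u)%N ->
  pa_expect u (fun g => (urn_frac u g - urn_frac s (take s g)) ^+ 2)
    <= \sum_(s <= j < u) (urn_total j.+1) ^- 2.
Proof.
move=> /andP[rs]; elim: u => [|u ih].
  rewrite leqn0 => /eqP s0; by rewrite s0 big_geq//= subrr expr0n.
rewrite leq_eqVlt => /predU1P[->|su].
  rewrite big_geq// -(pa_expect_cst u.+1 0); apply: le_pa_expect => g vg.
  have /andP[/eqP/(congr1 size) + _] := vg.
  by rewrite size_map size_iota => <-; rewrite take_size subrr expr0n.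
rewrite ltnS in su.
have -> : \sum_(s <= j < u.+1) urn_total j.+1 ^- 2 =
    \sum_(s <= j < u) urn_total j.+1 ^- 2 + urn_total u.+1 ^- 2 by rewrite big_nat_recr.
have -> : pa_expect u.+1 (fun g => (urn_frac u.+1 g - urn_frac s (take s g)) ^+ 2) =
    pa_expect u.+1 (fun g => (fun g' x => (x / urn_total u.+1 -
      urn_frac s (take s g')) ^+ 2) (take u g) (urn_mass u.+1 g)).
  by apply: eq_pa_expect => g _; rewrite take_takel.
rewrite (@pa_expect_urnS u (fun g' x => (x / urn_total u.+1 -
  urn_frac s (take s g')) ^+ 2)) ?(leq_trans rs su)//.
apply: le_trans (lerD (ih su) (lexx _)).
rewrite -(pa_expect_cst u (urn_total u.+1 ^- 2)) -pa_expectD.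
apply: le_pa_expect => g _.
rewrite urn_totalS {1}/urn_frac.
have t0 := urn_total_gt0 u; have t1 := urn_total_gt0 u.+1; rewrite urn_totalS in t1.
rewrite /urn_frac; set m := urn_mass u g; set a := _ / urn_total s.
set tau := urn_total u in t0 t1 *.
(* The martingale property kills the cross term; what is left is the conditional variance
   [p * (1 - p) / (tau + 1) ^ 2] with [p = m / tau]. *)
have -> : (m / (tau + 1) - a) ^+ 2 +
   (((m + 1) / (tau + 1) - a) ^+ 2 - (m / (tau + 1) - a) ^+ 2) * (m / tau) =
   (m / tau - a) ^+ 2 + (m / tau) * (1 - m / tau) * (tau + 1) ^- 2.
  by field; rewrite !gt_eqF.
rewrite lerD2l ler_piMl ?invr_ge0 ?exprn_ge0 ?(ltW t1)//.
by set p := m / tau; have := sqr_ge0 (p - 2^-1); rewrite expr2; lra.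
Qed.

Definition urn_moment k t g : R := rising (urn_mass t g) k / rising (urn_total t) k.

(** Since [m * rising (m + 1) k = rising m k * (m + k)], averaging over the step multiplies
    [rising m k] by [(tau + k) / tau], exactly the growth of [rising tau k]. *)
Lemma urn_moment_martingale k t : (r <= t)%N ->
  pa_expect t (urn_moment k t) = pa_expect r (urn_moment k r).
Proof.
elim: t => [|t ih]; first by rewrite leqn0 => /eqP ->.
rewrite leq_eqVlt => /predU1P[->//|]; rewrite ltnS => rt; rewrite -ih//.
have t0 := urn_total_gt0 t.
rewrite (@pa_expect_urnS t (fun _ x => rising x k / rising (urn_total t.+1) k))//.
apply: eq_pa_expect => g _; rewrite /urn_moment urn_totalS.
set m := urn_mass t g; set tau := urn_total t in t0 *.
have r1 : rising (tau + 1) k != 0 by rewrite gt_eqF// rising_gt0// addr_gt0.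
have r2 : rising tau k != 0 by rewrite gt_eqF// rising_gt0.
have em : m * rising (m + 1) k = rising m k * (m + k%:R) by rewrite -risingSl risingS.
have et : tau * rising (tau + 1) k = rising tau k * (tau + k%:R).
  by rewrite -risingSl risingS.
have -> : rising m k / rising (tau + 1) k +
    (rising (m + 1) k / rising (tau + 1) k - rising m k / rising (tau + 1) k) * (m / tau) =
   (rising m k * tau + m * rising (m + 1) k - rising m k * m)
     / (tau * rising (tau + 1) k).
  by field; rewrite r1 gt_eqF.
rewrite em et; field; rewrite r2 gt_eqF//.
by rewrite ltr_wpDr.
Qed.

(** Whether [r] has a loop is decided by its own edge, with a probability that does not depend on
    the past. *)
Lemma pa_expect_root (F : bool -> R) : (1 < r)%N ->
  pa_expect r (fun g => F (loops_at_root g)) =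
  (1 + delta) / ((2 + delta) * r%:R - 1) * F true +
  (2 + delta) * (r%:R - 1) / ((2 + delta) * r%:R - 1) * F false.
Proof.
have [q rE] : exists q, r = q.+1 by exists r.-1; rewrite prednK.
move=> _; rewrite rE pa_expectS.
have n0 := pa_norm_gt0 q.
have NE : pa_norm 1 delta q 1 = (2 + delta) * q.+1%:R - 1.
  by rewrite pa_normE -natr1; ring.
rewrite -[RHS](pa_expect_cst q); apply: eq_pa_expect => g vg.
have qE : attach_prob q g q.+1 = (1 + delta) / ((2 + delta) * q.+1%:R - 1).
  by rewrite /attach_prob ltnn NE.
have sE : \sum_(y <- iota 1 q) attach_prob q g y =
    (2 + delta) * (q.+1%:R - 1) / ((2 + delta) * q.+1%:R - 1).
  have := sum_attach_prob vg; rewrite iota1S big_cat big_seq1/= qE => h.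
  apply: (@addIr _ ((1 + delta) / ((2 + delta) * q.+1%:R - 1))); rewrite {}h.
  rewrite -mulrDl [X in X / _](_ : _ = (2 + delta) * q.+1%:R - 1); last by ring.
  by rewrite divff// -NE gt_eqF.
rewrite iota1S big_cat big_seq1/= qE addrC; congr (_ * _ + _).
  by rewrite /loops_at_root rE mem_rcons inE eqxx.
rewrite -sE mulr_suml big_seq [RHS]big_seq; apply: eq_bigr => y.
rewrite mem_iota add1n ltnS => /andP[_ yq]; congr (_ * F _).
rewrite /loops_at_root rE mem_rcons inE xpair_eqE eqxx/= gtn_eqF ?ltnS//=.
by apply/negP => /(valid_history_mem vg)[]; rewrite ltnn.
Qed.

Lemma urn_moment_root k : (1 < r)%N ->
  pa_expect r (urn_moment k r) =
  (1 + delta) / ((2 + delta) * r%:R - 1) * (rising 1 k / rising (urn_total r) k) +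
  (2 + delta) * (r%:R - 1) / ((2 + delta) * r%:R - 1)
    * (rising (1 - theta) k / rising (urn_total r) k).
Proof.
move=> r1.
pose F (b : bool) := rising (1 - (~~ b)%:R * theta) k / rising (urn_total r) k.
have := pa_expect_root F r1; rewrite /F/= mul0r mul1r subr0 => <-.
apply: eq_pa_expect => g _; rewrite /urn_moment /urn_mass num_descendants_root//.
Qed.

Lemma urn_mass_bounds t g : (r <= t)%N -> 0 < urn_mass t g <= urn_total t.
Proof.
move=> rt; have X1 : 1 <= (num_descendants g r t)%:R :> R.
  by rewrite ler1n num_descendants_gt0// r0.
have Xt : (num_descendants g r t)%:R <= t%:R :> R by rewrite ler_nat num_descendants_le.
rewrite /urn_mass /urn_total; move: theta0 theta1; case: (~~ _) => /=; lra.
Qed.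

End attachment_expectation.

(** * Law of the history *)

Section history_law.
Variables (R : realType) (d : measure_display) (T : measurableType d).
Variables (P : probability T R) (delta : R) (w : nat -> nat -> {RV P >-> nat}).
Hypotheses (hdelta : -1 < delta) (hw : pa_process 1 delta w).
Implicit Types (g : multigraph) (t : nat) (phi : multigraph -> R).

Definition pa_history t (omega : T) : multigraph :=
  pa_graph 1 (fun v j => w v j omega) t.

Lemma pa_historyE t omega :
  pa_history t omega = [seq (v, w v 1 omega) | v <- iota 1 t].
Proof. by rewrite /pa_history /pa_graph /pa_partial cats0 /= flatten_map1. Qed.

Lemma pa_historyS t omega :
  pa_history t.+1 omega = rcons (pa_history t omega) (t.+1, w t.+1 1 omega).
Proof.
by rewrite !pa_historyE iota1S map_cat cats1.
Qed.

Definition history_event t g : set T := [set omega | pa_history t omega = g].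

Lemma history_eventS t g y : history_event t.+1 (rcons g (t.+1, y)) =
  history_event t g `&` [set omega | w t.+1 1 omega = y].
Proof.
rewrite /history_event; apply/seteqP; split => omega /=; rewrite pa_historyS.
  by move=> /rcons_inj[-> ->].
by move=> [-> ->].
Qed.

Lemma measurable_history_event t g : measurable (history_event t g).
Proof.
elim: t g => [|t ih] g.
  have [->|g0] := eqVneq g [::].
    by rewrite (_ : history_event _ _ = setT)//; apply/seteqP; split.
  rewrite (_ : history_event _ _ = set0)//; apply/seteqP; split => // omega /= h.
  by move: g0; rewrite -h.
case/lastP: g => [|g [v y]].
  rewrite (_ : history_event _ _ = set0)//; apply/seteqP; by split.
have [->|vt] := eqVneq v t.+1; last first.
  rewrite (_ : history_event _ _ = set0)//; apply/seteqP; split => // omega.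
  rewrite /history_event /mkset pa_historyS => /rcons_inj[_ ve _].
  by rewrite ve eqxx in vt.
rewrite history_eventS; apply: measurableI; first exact: ih.
rewrite -[X in measurable X]/((w t.+1 1) @^-1` [set y]).
exact: measurable_funPTI.
Qed.

(** There are countably many multigraphs, so any preimage is a countable union of history events. *)
Lemma measurable_pa_history t phi : measurable_fun setT (phi \o pa_history t).
Proof.
move=> _ B mB; rewrite setTI.
rewrite (_ : _ @^-1` _ =
    \bigcup_(g : multigraph) (history_event t g `&` [set _ | B (phi g)])).
  apply: countable_bigcupT_measurable; first exact: countableP.
  move=> g; apply: measurableI; first exact: measurable_history_event.
  have [Bg|Bg] := pselect (B (phi g)).
    by rewrite (_ : [set _ | _] = setT)//; apply/seteqP; split.
  by rewrite (_ : [set _ | _] = set0)//; apply/seteqP; split.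
apply/seteqP; split => omega /=.
  by move=> Bo; exists (pa_history t omega).
by move=> [g _ []] /= <-.
Qed.

(** Merges the three axioms of the process, for the initial loop, attachment and later loops, into
    one transition rule. *)
Lemma prob_history_event t g y : valid_history t g -> (1 <= y <= t.+1)%N ->
  P (history_event t.+1 (rcons g (t.+1, y))) =
  (P (history_event t g) * (attach_prob delta t g y)%:E)%E.
Proof.
move=> vg /andP[y1 yt]; rewrite history_eventS.
case: t vg yt => [|t] vg yt.
  have -> : y = 1%N by apply/eqP; rewrite eqn_leq yt y1.
  have -> : [set omega | w 1 1 omega = 1%N] = setT.
    by apply/seteqP; split => // omega _; exact: (pa_init hw).
  rewrite setIT /attach_prob/= pa_normE mulr0 add0r divff ?mule1//.
  by rewrite gt_eqF//; move: hdelta; lra.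
rewrite /attach_prob; case: ifPn => [yt'|]; last first.
  rewrite -ltnNge => ty; have -> : y = t.+2 by apply/eqP; rewrite eqn_leq yt ty.
  have /= := pa_loop hw (t := t.+1) (i := 1%N) g isT isT.
  by rewrite (degree_gt vg)// add0r mul1r divr1; apply.
have /= := pa_attach hw (t := t.+1) (i := 1%N) g (x := y) isT isT.
by rewrite y1 yt'; apply.
Qed.

Definition hist_prob t g : R := fine (P (history_event t g)).

Lemma hist_probE t g : P (history_event t g) = (hist_prob t g)%:E.
Proof. by rewrite fineK// fin_num_measure//; exact: measurable_history_event. Qed.

Lemma sum_hist_prob t phi :
  \sum_(g <- histories t) phi g * hist_prob t g = pa_expect delta t phi.
Proof.
elim: t phi => [|t ih] phi.
  rewrite /= big_seq1 /hist_prob (_ : history_event _ _ = setT).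
    by rewrite probability_setT mulr1.
  by apply/seteqP; split.
rewrite historiesS big_allpairs_dep pa_expectS -ih.
rewrite big_seq [RHS]big_seq; apply: eq_bigr => g /histories_valid vg.
rewrite mulr_suml big_seq [RHS]big_seq; apply: eq_bigr => y.
rewrite mem_iota add1n ltnS => yt.
rewrite {1}/hist_prob prob_history_event// fineM//; last first.
  by rewrite fin_num_measure//; exact: measurable_history_event.
by rewrite -/(hist_prob t g) /=; ring.
Qed.

(** A finite simple function that agrees with [phi] of the history except on invalid histories,
    where it is 0. *)
Let weighted_sum t phi (omega : T) : \bar R :=
  (\sum_(g <- histories t) (phi g)%:E * (\1_(history_event t g) omega)%:E)%E.

Let weighted_sumE t phi omega : weighted_sum t phi omega =
  (if pa_history t omega \in histories t then phi (pa_history t omega) else 0)%:E.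
Proof.
rewrite /weighted_sum; set g0 := pa_history t omega.
have ind g : \1_(history_event t g) omega = (g == g0)%:R :> R.
  rewrite indicE; congr (nat_of_bool _)%:R; apply/idP/eqP.
    by rewrite inE => <-.
  by move=> ->; rewrite inE.
under eq_bigr do rewrite ind -EFinM.
rewrite sumEFin; congr EFin; case: ifPn => [gin|gnin].
  rewrite (bigD1_seq g0)//=; last exact: uniq_histories.
  rewrite eqxx mulr1 big1 ?addr0// => g /negbTE ->; exact: mulr0.
rewrite big_seq big1// => g gin; rewrite (_ : g == g0 = false) ?mulr0//.
by apply/negP => /eqP gE; rewrite gE (negbTE gnin) in gin.
Qed.

Let integral_weighted_sum t phi : (forall g, valid_history t g -> 0 <= phi g) ->
  (\int[P]_omega weighted_sum t phi omega = (pa_expect delta t phi)%:E)%E.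
Proof.
(* Truncation makes the function nonnegative everywhere, so the nonnegative integral splits over the
   sum. *)
move=> phi0; pose phi' g := if valid_history t g then phi g else 0.
have phi'0 g : 0 <= phi' g by rewrite /phi'; case: ifP => // /phi0.
transitivity (\int[P]_omega weighted_sum t phi' omega)%E.
  apply: eq_integral => omega _; rewrite !weighted_sumE; congr EFin.
  by case: ifPn => // /histories_valid; rewrite /phi' => ->.
rewrite /weighted_sum ge0_integral_sum//; last 2 first.
- move=> g; apply: measurable_funeM; apply/measurable_EFinP.
  by apply: measurable_indic; exact: measurable_history_event.
- by move=> g omega _; rewrite mule_ge0// lee_fin.
rewrite -sum_hist_prob -sumEFin big_seq [RHS]big_seq; apply: eq_bigr => g gin.
have mg := measurable_history_event t g.
rewrite ge0_integralZl//; last 2 first.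
- by apply/measurable_EFinP; exact: measurable_indic.
- by rewrite lee_fin.
rewrite integral_indic// setIT EFinM; congr (_%:E * _)%E; last exact: hist_probE.
by rewrite /phi' (histories_valid gin).
Qed.

(** Integrating the constant 1 shows that the valid histories carry the whole mass. After vertex 1
    the axioms fix probabilities only, so validity holds up to a null set. *)
Lemma pa_history_valid_ae t : {ae P, forall omega, pa_history t omega \in histories t}.
Proof.
pose A := [set omega | pa_history t omega \in histories t].
have mA : measurable A.
  pose phi g : R := (g \in histories t)%:R.
  have := @measurable_pa_history t phi measurableT [set 1] (measurable_set1 _).
  rewrite setTI (_ : _ @^-1` _ = A)//; apply/seteqP; split => omega /=.
    by rewrite /phi /A/=; case: (_ \in _) => // /eqP; rewrite eq_sym oner_eq0.
  by rewrite /A /phi/= => ->.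
have PA : P A = 1%E.
  have := @integral_weighted_sum t (fun=> 1) (fun _ _ => ler01).
  rewrite pa_expect_cst// => <-.
  rewrite -[in LHS](setIT A) -integral_indic//; apply: eq_integral => omega _.
  rewrite weighted_sumE indicE; congr EFin.
  by case: ifPn => h; [rewrite mem_set|rewrite memNset//; exact/negP].
exists (~` A); split; first exact: measurableC.
  by rewrite probability_setC// PA subee.
by move=> omega /=.
Qed.

Lemma integral_pa_history t phi : (forall g, valid_history t g -> 0 <= phi g) ->
  (\int[P]_omega (phi (pa_history t omega))%:E = (pa_expect delta t phi)%:E)%E.
Proof.
move=> phi0; rewrite -integral_weighted_sum//.
apply: ae_eq_integral => //.
- by apply/measurable_EFinP; exact: measurable_pa_history.
- rewrite (_ : weighted_sum t phi = EFin \o ((fun g =>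
      if g \in histories t then phi g else 0) \o pa_history t)).
    by apply/measurable_EFinP; exact: measurable_pa_history.
  by apply/funext => omega; rewrite weighted_sumE.
- apply: filterS (pa_history_valid_ae t) => omega h _.
  by rewrite weighted_sumE h.
Qed.

End history_law.

(** * Convergence of the proportion of descendants *)

Section cvg_along_subsequence.
Variable R : realType.

Lemma cvg_exprn (u : R^nat) (l : R) n :
  u k @[k --> \oo] --> l -> u k ^+ n @[k --> \oo] --> l ^+ n.
Proof.
move=> ul; elim: n => [|n ih].
  by under eq_fun do rewrite expr0; rewrite expr0; exact: cvg_cst.
by under eq_fun do rewrite exprS; rewrite exprS; exact: cvgM.
Qed.

Lemma cvg_sandwich (u a b : R^nat) (s : nat -> nat) (l : R) :
    (forall k, (s k < s k.+1)%N) ->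
    (forall k t, (s k <= t < s k.+1)%N -> a k <= u t <= b k) ->
    a k @[k --> \oo] --> l -> b k @[k --> \oo] --> l -> u t @[t --> \oo] --> l.
Proof.
move=> ss aub al bl; apply/cvgrPdist_le => e e0.
have [N _ HN] : \forall k \near \oo, `|l - a k| <= e /\ `|l - b k| <= e.
  near=> k; split; near: k; [move/cvgrPdist_le: al|move/cvgrPdist_le: bl]; exact.
exists (s N) => // t /= Nt.
have [k [Nk kt]] : exists k, (N <= k)%N /\ (s k <= t < s k.+1)%N.
  elim: t Nt => [|t ih] Nt.
    exists N; split => //; rewrite Nt/=; exact: leq_ltn_trans (leq0n _) (ss N).
  have [sNt|] := ltnP t (s N).
    exists N; split => //; rewrite Nt/=.
    have -> : t.+1 = s N by apply/eqP; rewrite eqn_leq sNt Nt.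
    exact: ss.
  move=> /ih[k [Nk /andP[kt tk]]].
  have [tk'|tk'] := ltnP t.+1 (s k.+1).
    by exists k; rewrite (leq_trans kt).
  exists k.+1; split; first exact: leqW.
  have -> : t.+1 = s k.+1 by apply/eqP; rewrite eqn_leq tk tk'.
  by rewrite leqnn ss.
have [/= la lb] := HN k Nk; have /andP[au ub] := aub k t kt.
move: la lb; rewrite !ler_distlC => /andP[la _] /andP[_ lb].
by rewrite (le_trans la au) (le_trans ub lb).
Unshelve. all: by end_near. Qed.

Variables (theta c : R) (X : nat -> nat) (q : nat).
Hypotheses (q1 : (1 < q)%N).
Hypothesis X_ndecr : forall s t, (q <= s <= t)%N -> (X s <= X t)%N.

(** Sparse enough for the weighted squared increments to be summable, dense enough for consecutive
    ratios to tend to 1; the shift by [q] starts the times after [q]. *)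
Definition quartic k : nat := ((k + q) ^ 4)%N.

Lemma quartic_lt k : (quartic k < quartic k.+1)%N.
Proof. by rewrite /quartic ltn_exp2r// addSn. Qed.

Lemma quartic_ge k : (q <= quartic k)%N.
Proof.
rewrite /quartic (leq_trans (leq_addl k q))// -{1}(expn1 (k + q)).
by rewrite leq_pexp2l// addn_gt0 (ltnW q1) orbT.
Qed.

(** For [n ^ 4 <= t < (n + 1) ^ 4], monotonicity puts [X t / t] between [X (n ^ 4) / (n + 1) ^ 4]
    and [X ((n + 1) ^ 4) / n ^ 4]. *)
Lemma cvg_quartic (l : R) :
    ((X (quartic k))%:R - c) / ((quartic k)%:R + 1 - theta) @[k --> \oo] --> l ->
    theta < 1 ->
  (X t)%:R / t%:R @[t --> \oo] --> l.
Proof.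
move=> Ml th1.
have hn k : (quartic k.+1)%:R = ((k + q).+1%:R : R) ^+ 4.
  by rewrite /quartic natrX addSn.
have hn0 k : (quartic k)%:R = ((k + q)%:R : R) ^+ 4 by rewrite /quartic natrX.
have p0 k : 0 < (k + q)%:R :> R by rewrite ltr0n addn_gt0 (ltnW q1) orbT.
have Q0 k : 0 < (quartic k)%:R :> R by rewrite hn0 exprn_gt0.
pose m k := ((X (quartic k))%:R - c) / ((quartic k)%:R + 1 - theta).
have XE k : (X (quartic k))%:R = m k * ((quartic k)%:R + 1 - theta) + c.
  by rewrite /m divfK ?subrK//; apply: lt0r_neq0; move: (Q0 k) th1; lra.
have h1 : (k + q).+1%:R^-1 @[k --> \oo] --> (0 : R).
  have := @cvg_harmonic_shift R q; apply: cvg_trans; apply: near_eq_cvg.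
  by apply: nearW => k; rewrite /= addnC.
have h2 : (k + q)%:R^-1 @[k --> \oo] --> (0 : R).
  have := @cvg_harmonic_shift R q.-1; apply: cvg_trans; apply: near_eq_cvg.
  by apply: nearW => k; rewrite /= -addSn prednK ?(ltnW q1)// addnC.
have h14 : (k + q).+1%:R^-1 ^+ 4 @[k --> \oo] --> (0 : R).
  by have := cvg_exprn (n := 4%N) h1; rewrite [0 ^+ 4]expr0n.
have h24 : (k + q)%:R^-1 ^+ 4 @[k --> \oo] --> (0 : R).
  by have := cvg_exprn (n := 4%N) h2; rewrite [0 ^+ 4]expr0n.
apply: (@cvg_sandwich _ (fun k => (X (quartic k))%:R / (quartic k.+1)%:R)
  (fun k => (X (quartic k.+1))%:R / (quartic k)%:R) quartic).
- exact: quartic_lt.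
- move=> k t /andP[kt tk].
  have t0 : 0 < t%:R :> R by rewrite (lt_le_trans (Q0 k))// ler_nat.
  apply/andP; split; apply: ler_pM; rewrite ?invr_ge0 ?ler0n//.
  + by rewrite ler_nat X_ndecr// quartic_ge.
  + by rewrite lef_pV2 ?posrE// ler_nat ltnW.
  + by rewrite ler_nat X_ndecr// (leq_trans (quartic_ge k) kt) ltnW.
  + by rewrite lef_pV2 ?posrE// ler_nat.
(* With [z = k + q] the lower bound is [(m k * (z ^ 4 + 1 - theta) + c) / (z + 1) ^ 4], expressed
   through [1 / (z + 1)], which tends to 0. *)
- have -> : (fun k => (X (quartic k))%:R / (quartic k.+1)%:R) = (fun k : nat =>
     m k * ((1 - (k + q).+1%:R^-1) ^+ 4 + (1 - theta) * (k + q).+1%:R^-1 ^+ 4)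
     + c * (k + q).+1%:R^-1 ^+ 4) :> (nat -> R).
    apply/funext => k; rewrite XE hn hn0 -!natr1; have := p0 k.
    move: (k + q)%:R => z z0.
    by field; rewrite gt_eqF// addr_gt0.
  rewrite -[X in _ --> X]addr0 -[X in _ --> X + _]mulr1 -(mulr0 c).
  apply: cvgD; last first.
    by apply: cvgMr; exact: h14.
  apply: cvgM; first exact: Ml.
  have e : (1 - 0) ^+ 4 + (1 - theta) * 0 = 1 :> R.
    by rewrite subr0 expr1n mulr0 addr0.
  rewrite -[X in _ --> X]e.
  apply: cvgD; last by apply: cvgMr; exact: h14.
  by apply: cvg_exprn; apply: cvgB => //; exact: cvg_cst.
- have -> : (fun k => (X (quartic k.+1))%:R / (quartic k)%:R) = (fun k : nat =>
     m k.+1 * ((1 + (k + q)%:R^-1) ^+ 4 + (1 - theta) * (k + q)%:R^-1 ^+ 4)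
     + c * (k + q)%:R^-1 ^+ 4) :> (nat -> R).
    apply/funext => k; rewrite XE hn hn0 -!natr1; have := p0 k.
    by move: (k + q)%:R => z z0; field; rewrite gt_eqF.
  rewrite -[X in _ --> X]addr0 -[X in _ --> X + _]mulr1 -(mulr0 c).
  apply: cvgD; last first.
    by apply: cvgMr; exact: h24.
  apply: cvgM; first by rewrite (cvg_shiftS m); exact: Ml.
  have e : (1 + 0) ^+ 4 + (1 - theta) * 0 = 1 :> R.
    by rewrite addr0 expr1n mulr0 addr0.
  rewrite -[X in _ --> X]e.
  apply: cvgD; last by apply: cvgMr; exact: h24.
  by apply: cvg_exprn; apply: cvgD => //; exact: cvg_cst.
Qed.

End cvg_along_subsequence.

Section summable_increments.
Variable R : realType.

(** Telescoping, from [1 / z ^ 2 <= 1 / (z - 1) - 1 / z]. *)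
Lemma sum_inv_sqr_le (q n : nat) : (1 < q)%N ->
  \sum_(0 <= k < n) ((k + q)%:R ^- 2 : R) <= 1.
Proof.
move=> q1.
suff : \sum_(0 <= k < n) ((k + q)%:R ^- 2 : R) <= (q.-1)%:R^-1 - (n + q.-1)%:R^-1.
  move=> /le_trans; apply; rewrite lerBlDr (@le_trans _ _ 1)//; last by rewrite lerDl.
  by rewrite invf_le1// ?ler1n ?ltr0n -ltnS prednK// ltnW.
elim: n => [|n ih]; first by rewrite big_geq// add0n subrr.
rewrite big_nat_recr//= -lerBrDr (le_trans ih)//.
have [p pE] : exists p, q.-1 = p.+1 by exists q.-2; move: q1; clear; case: q => [|[]].
have -> : (n + q = (n + p).+2)%N by rewrite -(prednK (ltnW q1)) pE !addnS.
rewrite pE addSn addnS; set x := (n + p).+1%:R : R.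
have -> : (n + p).+2%:R = x + 1 :> R by rewrite natr1.
have x0 : 0 < x by rewrite ltr0n.
rewrite -addrA lerD2l -opprD lerN2.
have -> : x^-1 = (x + 1)^-1 + (x * (x + 1))^-1.
  by field; rewrite !gt_eqF// addr_gt0.
rewrite lerD2l lef_pV2 ?posrE ?exprn_gt0 ?mulr_gt0 ?addr_gt0//.
by rewrite expr2 ler_wpM2r ?lerDl// addr_ge0// ltW.
Qed.

(* AM-GM: [`|x| <= z ^- 2 + z ^+ 2 * x ^+ 2] with [z = k + q]. *)
Lemma cvg_of_sqr_summable (u : R^nat) (q : nat) (B : R) : (1 < q)%N ->
    (forall n, \sum_(0 <= k < n) ((k + q)%:R ^+ 2 * (u k.+1 - u k) ^+ 2) <= B) ->
  cvgn u.
Proof.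
move=> q1 hB.
have nc : cvgn (series (fun k => u k.+1 - u k)).
  apply: normed_cvg; apply: nondecreasing_is_cvgn.
    apply/nondecreasing_seqP => n; rewrite /= !seriesEnat/= big_nat_recr//= lerDl.
    exact: normr_ge0.
  exists (1 + B) => _ [n _ <-]; rewrite /= /series/=.
  apply: le_trans (lerD (sum_inv_sqr_le n q1) (hB n)).
  rewrite -big_split/=; apply: ler_sum => k _.
  have : 0 < (k + q)%:R :> R by rewrite ltr0n addn_gt0 (ltnW q1) orbT.
  move: (k + q)%:R (u k.+1 - u k) => z x z0.
  rewrite -[x ^+ 2]real_normK ?num_real//; move: `|x| (normr_ge0 x) => y y0.
  have -> : z ^- 2 + z ^+ 2 * y ^+ 2 = (z^-1 - z * y) ^+ 2 + y + y.
    by field; rewrite gt_eqF.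
  have := sqr_ge0 (z^-1 - z * y); lra.
have : cvgn (series (fun k => u k.+1 - u k) + (fun=> u 0%N)).
  by apply: is_cvgD => //; exact: is_cvg_cst.
rewrite (_ : series _ + _ = u)//; apply/funext => n.
by rewrite fctE seriesEnat/= telescope_sumr// subrK.
Qed.

End summable_increments.

Section descendant_proportion.
Variables (R : realType) (d : measure_display) (T : measurableType d).
Variables (P : probability T R) (delta : R) (w : nat -> nat -> {RV P >-> nat}).
Variable r : nat.
Hypotheses (hdelta : -1 < delta) (hr : (1 < r)%N) (hw : pa_process 1 delta w).

Let theta : R := (2 + delta)^-1.
Let r0 : (0 < r)%N := ltnW hr.

Let theta1 : theta < 1.
Proof. by rewrite invf_lt1; move: hdelta; lra. Qed.

Definition proportion (t : nat) (omega : T) : R :=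
  (num_descendants (pa_history w t omega) r t)%:R / t%:R.

Definition always_valid (omega : T) :=
  forall t, valid_history t (pa_history w t omega).

Lemma always_valid_ae : {ae P, forall omega, always_valid omega}.
Proof.
apply: ae_foralln => t; apply: filterS (pa_history_valid_ae hdelta hw t) => omega.
exact: histories_valid.
Qed.

Lemma take_pa_history s t omega : (s <= t)%N ->
  take s (pa_history w t omega) = pa_history w s omega.
Proof. by move=> st; rewrite !pa_historyE -map_take take_iota (minn_idPl st). Qed.

Let X t omega := num_descendants (pa_history w t omega) r t.

Lemma num_descendants_ndecr omega s t : always_valid omega ->
  (r <= s <= t)%N -> (X s omega <= X t omega)%N.
Proof.
move=> av /andP[rs]; elim: t => [|t ih]; first by rewrite leqn0 => /eqP ->.
rewrite leq_eqVlt => /predU1P[->//|]; rewrite ltnS => st.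
rewrite (leq_trans (ih st))// /X pa_historyS num_descendants_rcons//.
  exact: leq_addr.
exact: leq_trans rs st.
Qed.

Lemma loops_at_root_history omega t : (r <= t)%N ->
  loops_at_root r (pa_history w t omega) = loops_at_root r (pa_history w r omega).
Proof.
elim: t => [|t ih]; first by rewrite leqNgt r0.
rewrite leq_eqVlt => /predU1P[->//|]; rewrite ltnS => rt.
rewrite -ih// pa_historyS /loops_at_root mem_rcons inE xpair_eqE.
by rewrite ltn_eqF// ltnS.
Qed.

Let frac t omega := urn_frac delta r t (pa_history w t omega).

Let fracE t omega : (r <= t)%N -> frac t omega =
  ((X t omega)%:R - (~~ loops_at_root r (pa_history w r omega))%:R * theta)
   / (t%:R + 1 - theta).
Proof. by move=> rt; rewrite /frac /urn_frac /urn_mass loops_at_root_history. Qed.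

Let sq_incr k omega : R :=
  (k + r)%:R ^+ 2 * (frac (quartic r k.+1) omega - frac (quartic r k) omega) ^+ 2.

(** The same quantity as a function of the later history alone, the form that [integral_pa_history]
    handles. *)
Let sq_incr_of k g : R := (k + r)%:R ^+ 2 *
  (urn_frac delta r (quartic r k.+1) g -
   urn_frac delta r (quartic r k) (take (quartic r k) g)) ^+ 2.

Let sq_incrE k : sq_incr k = sq_incr_of k \o pa_history w (quartic r k.+1).
Proof.
apply/funext => omega; rewrite /sq_incr /frac /comp /sq_incr_of take_pa_history//.
exact/ltnW/quartic_lt.
Qed.

Let measurable_sq_incr k : measurable_fun setT (sq_incr k).
Proof. by rewrite sq_incrE; exact: measurable_pa_history. Qed.

Let sq_incr_ge0 k omega : 0 <= sq_incr k omega.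
Proof. by rewrite /sq_incr mulr_ge0 ?sqr_ge0. Qed.

(** With [n = k + r], each of the [(n + 1) ^ 4 - n ^ 4] steps contributes at most [n ^ - 8]; this
    number of steps is at most [15 * n ^ 4], where [15 = 4 + 6 + 4 + 1]. *)
Let integral_sq_incr k :
  (\int[P]_omega (sq_incr k omega)%:E <= (15 * (k + r)%:R ^- 2)%:E)%E.
Proof.
have n1 : 1 <= (k + r)%:R :> R by rewrite ler1n (leq_trans r0) ?leq_addl.
have n0 : 0 < (k + r)%:R :> R by rewrite (lt_le_trans ltr01).
rewrite sq_incrE (integral_pa_history hdelta hw (phi := sq_incr_of k)); last first.
  by move=> g _; rewrite /sq_incr_of mulr_ge0 ?sqr_ge0.
rewrite lee_fin pa_expectZ//.
have rq : (r <= quartic r k <= quartic r k.+1)%N.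
  by rewrite quartic_ge// ltnW// quartic_lt.
apply: le_trans (ler_wpM2l _ (urn_frac_increment hdelta r0 rq)) _.
  by rewrite exprn_ge0// ltW.
apply: (@le_trans _ _ ((k + r)%:R ^+ 2 * \sum_(quartic r k <= j < quartic r k.+1)
    ((quartic r k)%:R ^- 2 : R))).
  apply: ler_wpM2l; first by rewrite exprn_ge0// ltW.
  apply: ler_sum_nat => j /andP[kj _].
  have q0 : 0 < (quartic r k)%:R :> R by rewrite /quartic natrX exprn_gt0.
  have qj : (quartic r k)%:R <= urn_total delta j.+1.
    rewrite /urn_total -natr1 -/theta.
    have : (quartic r k)%:R <= j%:R :> R by rewrite ler_nat.
    by move: theta1; lra.
  rewrite lef_pV2 ?posrE ?exprn_gt0//; last exact: lt_le_trans qj.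
  by rewrite ler_pXn2r// nnegrE ltW// (lt_le_trans q0).
rewrite sumr_const_nat -[_ *+ (_ - _)]mulr_natr natrB; last by case/andP: rq.
rewrite /quartic !natrX addSn -natr1; move: n0 n1; move: (k + r)%:R => z z0 z1.
have -> : z ^+ 2 * ((z ^+ 4) ^- 2 * ((z + 1) ^+ 4 - z ^+ 4)) =
    (4 * z ^+ 3 + 6 * z ^+ 2 + 4 * z + 1) / z ^+ 4 * z ^- 2.
  by field; rewrite gt_eqF.
rewrite ler_wpM2r ?invr_ge0 ?exprn_ge0 ?(ltW z0)// ler_pdivrMr ?exprn_gt0//.
have z2 : z <= z ^+ 2 by rewrite expr2 ler_peMr// ltW.
have z3 : z ^+ 2 <= z ^+ 3 by rewrite [z ^+ 3]exprS ler_peMl// exprn_ge0// ltW.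
have z4 : z ^+ 3 <= z ^+ 4 by rewrite [z ^+ 4]exprS ler_peMl// exprn_ge0// ltW.
by move: z1 z2 z3 z4; move: (z ^+ 2) (z ^+ 3) (z ^+ 4) => *; lra.
Qed.

(** The sum of the weighted squared increments has expectation at most 15, hence is almost surely
    finite; there the fraction converges along the fourth powers, and [cvg_quartic] extends this to
    the proportion at all times. *)
Lemma proportion_cvg_ae :
  {ae P, forall omega, cvgn (proportion ^~ omega)}.
Proof.
pose S omega := (\sum_(0 <= k <oo) (sq_incr k omega)%:E)%E.
have mS k : measurable_fun setT (fun omega => (sq_incr k omega)%:E).
  by apply/measurable_EFinP.
have iS : P.-integrable setT S.
  apply/integrableP; split.
    by apply: ge0_emeasurable_sum => [k omega _ _|k _]; [rewrite lee_fin|exact: mS].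
  rewrite (eq_integral S); last first.
    move=> omega _; rewrite gee0_abs//; apply: nneseries_ge0 => k _ _.
    by rewrite lee_fin.
  rewrite integral_nneseries//; last by move=> k omega _; rewrite lee_fin.
  apply: (@le_lt_trans _ _ 15%:E); last exact: ltry.
  apply: lime_le.
    by apply: is_cvg_nneseries => k _ _; apply: integral_ge0 => omega _; rewrite lee_fin.
  apply: nearW => n.
  apply: (@le_trans _ _ (\sum_(0 <= k < n) (15 * (k + r)%:R ^- 2)%:E)%E).
    by apply: lee_sum => k _; exact: integral_sq_incr.
  by rewrite sumEFin lee_fin -mulr_sumr ler_piMr// sum_inv_sqr_le.
have := integrable_ae measurableT iS; move=> fS.
have := always_valid_ae; move=> av.
near=> omega.
have fSo : S omega \is a fin_num by near: omega; apply: filterS fS => omega; apply.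
have avo : always_valid omega by near: omega.
have bnd n : \sum_(0 <= k < n) sq_incr k omega <= fine (S omega).
  rewrite -lee_fin fineK// -sumEFin; apply: nneseries_lim_ge => k _ _.
  by rewrite lee_fin.
have cv := cvg_of_sqr_summable (u := fun k => frac (quartic r k) omega) hr bnd.
apply/cvg_ex; exists (limn (fun k => frac (quartic r k) omega)).
apply: (@cvg_quartic R theta
  ((~~ loops_at_root r (pa_history w r omega))%:R * theta) (X ^~ omega) r) => //.
  by move=> s t; exact: num_descendants_ndecr.
move: cv; apply: cvg_trans; apply: near_eq_cvg; apply: nearW => k.
by rewrite fracE// quartic_ge.
Unshelve. all: by end_near. Qed.

Lemma proportion01 t omega : 0 <= proportion t omega <= 1.
Proof.
rewrite /proportion divr_ge0//=; case: t => [|t]; first by rewrite invr0 mulr0.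
by rewrite ler_pdivrMr// mul1r ler_nat num_descendants_le.
Qed.

Lemma measurable_proportion t : measurable_fun setT (proportion t).
Proof.
exact: (measurable_pa_history w t (fun g => (num_descendants g r t)%:R / t%:R)).
Qed.

(** The upper limit is defined and measurable everywhere, including where the proportion does not
    converge. *)
Definition proportion_limit (omega : T) : R := limn_sup (proportion ^~ omega).

Lemma measurable_proportion_limit : measurable_fun setT proportion_limit.
Proof.
apply: measurable_fun_limn_sup => [omega _|omega _|t].
- by exists 1 => _ [t _ <-]; have /andP[] := proportion01 t omega.
- by exists 0 => _ [t _ <-]; have /andP[] := proportion01 t omega.
- exact: measurable_proportion.
Qed.

Lemma proportion_limit_ae :
  {ae P, forall omega, proportion t omega @[t --> \oo] --> proportion_limit omega}.
Proof.
apply: filterS proportion_cvg_ae => omega cv.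
by rewrite /proportion_limit cvg_limn_supE.
Qed.

(** The ratio is a product of [k] factors, and the bounded shifts in each are negligible against
    [t]. *)
Lemma urn_moment_cvg omega (l : R) k :
  proportion t omega @[t --> \oo] --> l ->
  urn_moment delta r k t (pa_history w t omega) @[t --> \oo] --> l ^+ k.
Proof.
move=> pl; pose c := (~~ loops_at_root r (pa_history w r omega))%:R * theta.
have inv0 (a : R) : a / t%:R @[t --> \oo] --> 0.
  rewrite -(mulr0 a); apply: cvgMr; rewrite -(cvg_shiftS (fun t : nat => t%:R^-1 : R)).
  exact: cvg_harmonic.
have factor i : ((X t omega)%:R - c + i) / (t%:R + 1 - theta + i) @[t --> \oo] --> l.
  have -> : l = (l + 0) / (1 + 0) by rewrite !addr0 divr1.
  apply: (@cvg_trans _ ((proportion t omega + (i - c) / t%:R)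
      / (1 + (1 - theta + i) / t%:R) @[t --> \oo])); last first.
    apply: cvgM; first by apply: cvgD => //; exact: inv0.
    apply: cvgV; first by rewrite addr0 oner_neq0.
    by apply: cvgD; [exact: cvg_cst|exact: inv0].
  apply: near_eq_cvg; near=> t.
  have t0 : 0 < t%:R :> R by rewrite ltr0n; near: t; exact: nbhs_infty_gt.
  have ti : `|i| < t%:R by near: t; exact: nbhs_infty_gtr.
  have ti0 : 0 < t%:R + 1 - theta + i.
    by move: ti theta1; rewrite ltr_norml => /andP[]; lra.
  rewrite /proportion -/(X t omega).
  have -> : 1 + (1 - theta + i) / t%:R = (t%:R + 1 - theta + i) / t%:R.
    by field; rewrite gt_eqF.
  by field; rewrite !gt_eqF.
suff h : rising ((X t omega)%:R - c) k / rising (t%:R + 1 - theta) k @[t --> \oo] --> l ^+ k.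
  move: h; apply: cvg_trans; apply: near_eq_cvg; near=> t.
  rewrite /urn_moment /urn_mass loops_at_root_history//.
  by near: t; exact: nbhs_infty_ge.
elim: k => [|k ih].
  by under eq_fun do rewrite !rising0 divr1; rewrite expr0; exact: cvg_cst.
under eq_fun do rewrite !risingS invfM mulrACA.
by rewrite exprSr; apply: cvgM => //; exact: factor.
Unshelve. all: by end_near. Qed.

Lemma proportion_limit01_ae :
  {ae P, forall omega, 0 <= proportion_limit omega <= 1}.
Proof.
apply: filterS proportion_limit_ae => omega pl; apply/andP; split.
  by apply: (cvgr_to_ge pl); apply: nearW => t; have /andP[] := proportion01 t omega.
by apply: (cvgr_to_le pl); apply: nearW => t; have /andP[] := proportion01 t omega.
Qed.

Lemma proportion_limit_moment k :
  (\int[P]_omega (proportion_limit omega ^+ k)%:E =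
   (pa_expect delta r (urn_moment delta r k r))%:E)%E.
Proof.
(* Times start at [r], where the martingale starts; its values lie in [[0, 1]], so the constant 1
   dominates. *)
pose f n omega : \bar R := (urn_moment delta r k (n + r) (pa_history w (n + r) omega))%:E.
have fE n : (\int[P]_omega f n omega = (pa_expect delta r (urn_moment delta r k r))%:E)%E.
  rewrite /f (integral_pa_history hdelta hw); last first.
    move=> g _; have /andP[m0 _] := urn_mass_bounds hdelta r0 g (leq_addl n r).
    by rewrite divr_ge0// ltW// rising_gt0// urn_total_gt0.
  by rewrite urn_moment_martingale// leq_addl.
have [| | | | |_ _] := @dominated_convergence _ _ _ P setT measurableT f
    (fun omega => (proportion_limit omega ^+ k)%:E) (cst 1%E).
- move=> n; apply/measurable_EFinP.
  exact: (measurable_pa_history w (n + r) (urn_moment delta r k (n + r))).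
- apply/measurable_EFinP; apply: measurable_funX.
  exact: measurable_proportion_limit.
- near=> omega => _; apply: cvg_EFin; first exact: nearW.
  have pl : proportion t omega @[t --> \oo] --> proportion_limit omega.
    by near: omega; exact: proportion_limit_ae.
  by have := urn_moment_cvg (k := k) pl; rewrite -(cvg_shiftn r).
- exact: finite_measure_integrable_cst.
- apply: aeW => omega n _ /=; rewrite lee_fin.
  have /andP[m0 m1] := urn_mass_bounds hdelta r0 (pa_history w (n + r) omega) (leq_addl n r).
  have t0 := urn_total_gt0 hdelta (n + r).
  rewrite ger0_norm; last by rewrite divr_ge0// ltW// rising_gt0.
  rewrite ler_pdivrMr ?rising_gt0// mul1r; apply: ler_prod => i _.
  by rewrite addr_ge0 ?(ltW m0)//= lerD2r.
rewrite /mk_sequence; under eq_fun do rewrite fE; move=> h.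
by apply: esym; apply: cvg_unique h; [exact: ereal_hausdorff|exact: cvg_cst].
Unshelve. all: by end_near. Qed.

End descendant_proportion.

(** * The almost sure limit and its law *)

Theorem theorem2p2 (R : realType) (d : measure_display) (T : measurableType d)
    (P : probability T R) (delta : R) (w : nat -> nat -> {RV P >-> nat})
    (r : nat) (hdelta : -1 < delta) (hr : (2 <= r)%N)
    (hw : pa_process 1 delta w) :
  let p (t : nat) (omega : T) : R :=
    (pa_descendants 1 (fun v j => w v j omega) r t)%:R / t%:R in
  (exists Z : {RV P >-> R},
     {ae P, forall omega, p t omega @[t --> \oo] --> Z omega} /\
     forall A : set R, measurable A ->
       distribution P Z A =
       (((1 + delta) / ((2 + delta) * r%:R - 1))%:E
          * beta_law 1 (r%:R - 1 / (2 + delta)) A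
        + ((2 + delta) * (r%:R - 1) / ((2 + delta) * r%:R - 1))%:E
          * beta_law ((1 + delta) / (2 + delta)) r%:R A)%E) /\
  {ae P, forall omega, (0 < limn_einf (fun t => (p t omega)%:E))%E}.
Proof.
move=> p.
have hr1 : (1 < r)%N := hr.
have d2 : 0 < 2 + delta by move: hdelta; lra.
pose theta : R := (2 + delta)^-1.
have th0 : 0 < theta by rewrite invr_gt0.
have th1 : theta < 1 by rewrite invf_lt1//; move: hdelta; lra.
pose L := proportion_limit w r.
(* Clamping changes [L] on a null set only and gives the bounds at every point that [law_of_moments]
   asks for. *)
pose Zf omega := Num.max 0 (Num.min 1 (L omega)).
have mZ : measurable_fun setT Zf.
  apply: measurable_maxr; first exact: measurable_cst.
  apply: measurable_minr; first exact: measurable_cst.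
  exact: measurable_proportion_limit.
pose Z : {RV P >-> R} := HB.pack Zf (isMeasurableFun.Build _ _ _ _ Zf mZ).
have ZL : {ae P, forall omega, Zf omega = L omega}.
  apply: filterS (proportion_limit01_ae hdelta hr1 hw) => omega /andP[l0 l1].
  by rewrite /Zf min_r// max_r.
have Zcvg : {ae P, forall omega, p t omega @[t --> \oo] --> Z omega}.
  near=> omega.
  have -> : Z omega = L omega by near: omega; exact: ZL.
  by near: omega; exact: (proportion_limit_ae hdelta hr1 hw).
have Z01 omega : 0 <= Z omega <= 1.
  by rewrite /= /Zf le_max lexx/= ge_max ler01/= ge_min lexx.
pose W1 := (1 + delta) / ((2 + delta) * r%:R - 1).
pose W2 := (2 + delta) * (r%:R - 1) / ((2 + delta) * r%:R - 1).
have rge : 2 <= r%:R :> R by rewrite (ler_nat _ 2 r).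
have N0 : 0 < (2 + delta) * r%:R - 1.
  rewrite subr_gt0 (@lt_le_trans _ _ ((2 + delta) * 2))//; last by rewrite ler_pM2l.
  by move: hdelta; lra.
have W10 : 0 <= W1 by rewrite divr_ge0 ?(ltW N0)//; move: hdelta; lra.
have W20 : 0 <= W2.
  by rewrite divr_ge0 ?(ltW N0)// mulr_ge0 ?(ltW d2)//; move: rge; lra.
pose b : R := r%:R - 1 / (2 + delta).
pose a : R := (1 + delta) / (2 + delta).
have aE : a = 1 - theta by rewrite /a /theta; field; rewrite gt_eqF.
(* Writing [b = a + q] and [r = q + 1] brings both beta laws to the form of the moment lemmas; their
   parameters have the same sum, the urn total at time [r]. *)
have [q rE] : exists q, r = q.+1 by exists r.-1; rewrite prednK// ltnW.
have bE : b = a + q%:R by rewrite aE /b /theta rE -natr1 div1r; ring.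
have a01 : 0 < a <= 1 by rewrite aE; apply/andP; split; lra.
have tE : urn_total delta r = 1 + b.
  by rewrite /urn_total /b div1r; ring.
have tE' : urn_total delta r = a + r%:R.
  by rewrite /urn_total aE /theta; ring.
pose h := beta_mixture W1 W2 1 b a r%:R.
have h0 x : 0 <= h x by rewrite addr_ge0// mulr_ge0// beta_density_ge0.
have mh : measurable_fun setT h.
  by apply: measurable_funD; apply: measurable_funM => //; exact: measurable_beta_density.
have law A : measurable A -> distribution P Z A =
    (W1%:E * beta_law 1 b A + W2%:E * beta_law a r%:R A)%E.
  move=> mA; rewrite (law_of_moments Z01 h0 mh)//; last first.
    move=> k; exists (pa_expect delta r (urn_moment delta r k r)).
      rewrite -(proportion_limit_moment hdelta hr1 hw).
      apply: ae_eq_integral => //.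
      - by apply/measurable_EFinP; apply: measurable_funX.
      - apply/measurable_EFinP; apply: measurable_funX.
        exact: measurable_proportion_limit.
      - by apply: filterS ZL => omega /= -> _.
    rewrite (urn_moment_root hdelta) ?(ltnW hr1)//.
    rewrite integral_beta_mixture//; last first.
      by move=> x /=; rewrite in_itv/= => /andP[/ltW x0 _]; exact: exprn_ge0.
    have m1 := beta_moment_1l q k a01; rewrite -bE -tE in m1.
    have m2 := beta_moment_natr q k a01; rewrite -rE -tE' in m2.
    by rewrite m1 m2 -!EFinM -EFinD aE.
  have mD : measurable (A `&` [set` `]0%R, 1%R[]).
    by apply: measurableI => //; exact: measurable_itv.
  transitivity (\int[lebesgue_measure]_(x in A `&` `]0%R, 1%R[) (cst 1 x * h x)%:E)%E.
    by apply: eq_integral => x _; rewrite mul1r.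
  rewrite integral_beta_mixture// /beta_law.
  by congr (_ * _ + _ * _)%E; apply: eq_integral => x _; rewrite mul1r.
split; first by exists Z.
have Zpos : {ae P, forall omega, 0 < Z omega}.
  (* Both beta laws live on []0, 1[], so the limit is nonpositive with probability 0. *)
  exists (Z @^-1` [set` `]-oo, (0 : R)]]); split.
  - by apply: measurable_funPTI; exact: measurable_itv.
  - have := law [set` `]-oo, (0 : R)]] (measurable_itv _).
    rewrite /beta_law (_ : _ `&` _ = set0) ?integral_set0 ?mule0 ?adde0//.
    apply/seteqP; split => x //=; rewrite !in_itv/= => -[x0 /andP[x0' _]].
    by move: x0; rewrite leNgt x0'.
  - by move=> omega /=; rewrite in_itv/= => /negP; rewrite -leNgt.
near=> omega.
have cv : p t omega @[t --> \oo] --> Z omega by near: omega; exact: Zcvg.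
have -> : limn_einf (fun t => (p t omega)%:E) = (Z omega)%:E.
  by apply: (cvg_limn_einf_sup _).1; apply: cvg_EFin => //; exact: nearW.
by rewrite lte_fin; near: omega; exact: Zpos.
Unshelve. all: by end_near. Qed.
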